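(* Let $\lambda\vdash n$ be a strict partition. Then $$ch([\mathbf{N}_{\mathsf{SShT}(\lambda)}])=\sum_{S\in\mathsf{SShT}(\lambda)}F_{\mathrm{comp}_n(\mathrm{Des}(S))}\qquad\text{and}\qquad \widetilde{ch}([\widetilde{\mathbf{N}}_{\mathsf{SShT}(\lambda)}])=Q_\lambda,$$ where $Q_\lambda$ is the Schur $Q$-function indexed by $\lambda$.
   Context: Compositions. A composition $\alpha=(\alpha_1,\dots,\alpha_k)\vDash n$ is a sequence of positive integers with sum $n$; $\mathrm{Des}(\alpha)=\{\alpha_1,\alpha_1+\alpha_2,\dots,\alpha_1+\cdots+\alpha_{k-1}\}\subseteq [n-1]$, where $[m]=\{1,\dots,m\}$; $\mathrm{comp}_n(X)$ is the composition of $n$ with descent set $X\subseteq[n-1]$. For a set $X$ of positive integers, $\mathrm{Peak}(X)=\{i\in X: i>1,\ i-1\notin X\}$; $\mathrm{Peak}(\alpha)=\mathrm{Peak}(\mathrm{Des}(\alpha))$. A peak composition is a composition all of whose parts, except possibly the last, are greater than $1$. Functions. For $\alpha\vDash n$, $F_\alpha=\sum x_{i_1}\cdots x_{i_n}$ over positive integers $i_1\le\cdots\le i_n$ with $i_j<i_{j+1}$ whenever $j\in\mathrm{Des}(\alpha)$; these form a basis of $\mathsf{QSym}$. For a peak composition $\alpha\vDash n$, $K_\alpha=2^{|\mathrm{Peak}(\alpha)|+1}\sum_\beta F_\beta$, sum over $\beta\vDash n$ with $\mathrm{Peak}(\alpha)\subseteq \mathrm{Des}(\beta)\triangle(\mathrm{Des}(\beta)+1)$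 ($X+1=\{x+1:x\in X\}$). The peak algebra $\mathsf{Peak}$ has basis the functions $K_\alpha$. Algebras. $H_n(0)$ is the $\mathbb{C}$-algebra with generators $\pi_1,\dots,\pi_{n-1}$ and relations $\pi_i^2=-\pi_i$, $\pi_i\pi_j=\pi_j\pi_i$ for $|i-j|\ge2$, $\pi_i\pi_{i+1}\pi_i=\pi_{i+1}\pi_i\pi_{i+1}$. $HCl_n(0)$ is generated by $\pi_1,\dots,\pi_{n-1}$ (with these relations) and $c_1,\dots,c_n$ with $c_i^2=-1$, $c_ic_j=-c_jc_i$ for $i\ne j$, and $\pi_ic_j=c_j\pi_i$ for $j\ne i,i+1$, $\pi_ic_i=c_{i+1}\pi_i$, $(\pi_i+1)c_{i+1}=c_i(\pi_i+1)$. It is a superalgebra with $\pi_i$ of degree $0$, $c_j$ of degree $1$. Characteristics. For $\alpha\vDash n$, $\mathbf{F}_\alpha=\mathbb{C}v_\alpha$ is the simple $H_n(0)$-module with $\pi_iv_\alpha=-v_\alpha$ if $i\in\mathrm{Des}(\alpha)$ and $0$ otherwise, and $\mathbf{M}_\alpha$ is the $HCl_n(0)$-supermodule induced from $\mathbf{F}_\alpha$. The quasisymmetric characteristic $ch:\bigoplus_n\mathcal{G}_0(H_n(0))\to\mathsf{QSym}$ is the isomorphism (Duchamp, Krob, Leclerc, Thibon) with $ch([\mathbf{F}_\alpha])=F_\alpha$. The peak characteristic $\widetilde{ch}:\bigoplus_n\mathcal{G}_0(HCl_n(0))\to\mathsf{Peak}$ is the isomorphism (Bergeron, Hivert, Thibon)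 which satisfies $\widetilde{ch}([\mathbf{M}_\alpha])=K_{\mathrm{comp}_n(\mathrm{Peak}(\alpha))}$ for $\alpha\vDash n$. Here $\mathcal{G}_0$ is the Grothendieck group of finite-dimensional (super)modules. Diagram modules. Let $D$ be a diagram of $n$ boxes with a reading order (a total order on the boxes). A standard filling is a bijective assignment of $1,\dots,n$ to the boxes; $\mathrm{rw}(T)$ is the permutation given by the entries of $T$ in reading order from left to right; $s_iT$ exchanges the entries $i,i+1$ of $T$. For a nonempty set $\mathcal{T}$ of standard fillings and $T\in\mathcal{T}$, $\mathrm{Des}(T)$ is the set of $i\in[n-1]$ with $i$ to the right of $i+1$ in $\mathrm{rw}(T)$, and $\mathrm{Peak}(T)=\mathrm{Peak}(\mathrm{Des}(T))$. Elements of $[n-1]\setminus\mathrm{Des}(T)$ are ascents; an ascent $i$ is attacking if $s_iT\notin\mathcal{T}$ and nonattacking otherwise. $T$ has an ascent in positions $(r,s)$ if $r<s$ and $\mathrm{rw}(T)_s-\mathrm{rw}(T)_r=1$. $\mathcal{T}$ is ascent-compatible if whenever $T,T'\in\mathcal{T}$ both have an ascent in positions $(r,s)$, it is attacking in $T$ if and only if it is attacking in $T'$. In that case $\mathbf{N}_{\mathcal{T}}$ is the $H_n(0)$-module on the $\mathbb{C}$-span of $\mathcal{T}$ with $\pi_iT=-T$ if $i\in\mathrm{Des}(T)$, $0$ if $i$ is an attacking ascent, $s_iT$ if $i$ is a nonattacking ascent; and $\widetilde{\mathbf{N}}_{\mathcal{T}}=\mathrm{Ind}_{H_n(0)}^{HCl_n(0)}\mathbf{N}_{\mathcal{T}}$.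 Tableaux. A strict partition $\lambda\vdash n$ is a strictly decreasing sequence of positive integers with sum $n$. Its shifted diagram $\mathrm{ShD}(\lambda)$ has $\lambda_i$ boxes in row $i$ (rows numbered from bottom to top), in columns $i,i+1,\dots,i+\lambda_i-1$. $\mathsf{SShT}(\lambda)$ is the set of standard fillings of $\mathrm{ShD}(\lambda)$ with entries increasing from left to right along each row and from bottom to top in each column. The reading order reads rows from left to right, starting at the top row and proceeding downwards. $\mathsf{SShT}(\lambda)$ is ascent-compatible for this reading order. The Schur $Q$-function is given by $Q_\lambda=\sum_{S\in\mathsf{SShT}(\lambda)}K_{\mathrm{comp}_n(\mathrm{Peak}(S))}$. *)

(* Defs.v *)
From HB Require Import structures.
From mathcomp Require Import all_boot all_order all_fingroup all_algebra.
From mathcomp Require Import generic_quotient zify.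
From mathcomp Require Import finmap multiset.
From mathcomp Require Import boolp classical_sets functions.
From mathcomp Require Import monalg.
Set Implicit Arguments.
Unset Strict Implicit.
Unset Printing Implicit Defensive.
Import GRing.Theory.
Local Open Scope quotient_scope.
Local Open Scope ring_scope.

Definition is_composition (n : nat) (a : seq nat) : bool :=
  all (fun k => 0 < k)%N a && (sumn a == n).

(* A composition of n has at most n parts, each of them at most n. *)
Definition composition (n : nat) : Type :=
  {b : n.-bseq 'I_n.+1 | is_composition n (map val b)}.
HB.instance Definition _ n := Finite.on (composition n).
Definition parts n (a : composition n) : seq nat := map val (val (val a)).
Coercion parts : composition >-> seq.

Definition Des (a : seq nat) : {fset nat} :=
  [fset sumn (take k a) | k in iota 1 (size a).-1]%fset.

Definition comp_of_set (n : nat) (X : {fset nat}) : seq nat :=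
  if n is 0%N then [::]
  else pairmap (fun a b => b - a)%N 0%N (rcons [seq i <- iota 1 n.-1 | i \in X] n).

Definition Peak (X : {fset nat}) : {fset nat} :=
  [fset i in X | (1 < i)%N && (i.-1 \notin X)]%fset.

Definition is_peak_composition (a : seq nat) : bool :=
  all (fun k => 1 < k)%N (take (size a).-1 a).

Definition succ_set (X : {fset nat}) : {fset nat} := [fset x.+1 | x in X]%fset.
Definition symdiff (X Y : {fset nat}) : {fset nat} :=
  ((X `\` Y) `|` (Y `\` X))%fset.

(* Formal power series in x_1, x_2, ...: a monomial is the multiset of the
   indices of its variables, and a series is its family of coefficients. *)

Definition series (K : fieldType) : Type := {mset nat}%mset -> K^o.
HB.instance Definition _ (K : fieldType) := GRing.Lmodule.on (series K).

(* i_1 <= ... <= i_n in positive integers, with i_j < i_(j+1) for j in Des a *)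
Definition compatible_word (a w : seq nat) : bool :=
  [&& size w == sumn a, all (fun x => 0 < x)%N w &
   all (fun j => if j \in Des a then nth 0 w j.-1 < nth 0 w j
                 else nth 0 w j.-1 <= nth 0 w j)%N (iota 1 (sumn a).-1)].

(* The coefficient of a monomial counts the words having that monomial as
   product of letters; these are the rearrangements of one another. *)
Definition Ffun (K : fieldType) (a : seq nat) : series K :=
  fun m => (count (compatible_word a) (permutations (enum_mset m)))%:R.

Definition Kfun (K : fieldType) (n : nat) (a : seq nat) : series K :=
  (2 ^+ (#|` Peak (Des a)|.+1) : K) *:
    \sum_(b : composition n |
            (Peak (Des a) `<=` symdiff (Des b) (succ_set (Des b)))%fset)
       Ffun K b.

Definition QSym (K : fieldType) (n : nat) : set (series K) :=
  [set f | exists x : composition n -> K, f = \sum_(b : composition n) x b *: Ffun K b].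

Definition PeakAlg (K : fieldType) (n : nat) : set (series K) :=
  [set f | exists x : composition n -> K,
     f = \sum_(b : composition n | is_peak_composition b) x b *: Kfun K n b].

Inductive lspan (K : fieldType) (V : lmodType K) (S : set V) : V -> Prop :=
| lspan0 : lspan S 0
| lspanDZ (a : K) (u v : V) : S u -> lspan S v -> lspan S (a *: u + v).

Section QuotientSpace.
Variables (K : fieldType) (V : lmodType K) (S : set V).

Lemma lspan_add u v : lspan S u -> lspan S v -> lspan S (u + v).
Proof.
move=> su sv; elim: su => [|a x y Sx _ IH]; first by rewrite add0r.
by rewrite -addrA; apply: lspanDZ.
Qed.

Lemma lspan_scale a u : lspan S u -> lspan S (a *: u).
Proof.
elim=> [|b x y Sx _ IH]; first by rewrite scaler0; apply: lspan0.
by rewrite scalerDr scalerA; apply: lspanDZ.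
Qed.

Definition lspan_eqv (u v : V) : bool := `[< lspan S (u - v) >].

Lemma lspan_eqv_equiv : equiv_class_of lspan_eqv.
Proof.
split=> [u|u v|v u w].
- by apply/asboolP; rewrite subrr; apply: lspan0.
- by apply/asboolP/asboolP => /(lspan_scale (-1)); rewrite scaleN1r opprB.
- move=> /asboolP uv /asboolP vw; apply/asboolP.
  by have := lspan_add uv vw; rewrite addrA subrK.
Qed.
Canonical lspan_equiv := EquivRelPack lspan_eqv_equiv.

Definition quotient_space : Type := {eq_quot lspan_eqv}.
HB.instance Definition _ := Choice.on quotient_space.

Definition qpi (v : V) : quotient_space := \pi_({eq_quot lspan_eqv}) v.
Definition qrepr (x : quotient_space) : V := repr (x : {eq_quot lspan_eqv}).

Lemma qpi_eq u v : qpi u = qpi v <-> lspan S (u - v).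
Proof.
by split=> [/eqmodP/asboolP|H] //; apply/eqmodP/asboolP.
Qed.
Lemma qreprK x : qpi (qrepr x) = x.
Proof. exact: reprK. Qed.
Lemma qreprP v : lspan S (qrepr (qpi v) - v).
Proof. by apply/qpi_eq; rewrite qreprK. Qed.

Definition qadd x y := qpi (qrepr x + qrepr y).
Definition qopp x := qpi (- qrepr x).
Definition qscale (a : K) x := qpi (a *: qrepr x).

Lemma qpiD u v : qpi (u + v) = qadd (qpi u) (qpi v).
Proof.
apply/qpi_eq; rewrite opprD addrACA; apply: lspan_add.
  by rewrite -opprB -scaleN1r; apply/lspan_scale/qreprP.
by rewrite -opprB -scaleN1r; apply/lspan_scale/qreprP.
Qed.
Lemma qpiZ a u : qpi (a *: u) = qscale a (qpi u).
Proof.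
apply/qpi_eq; rewrite -scalerBr; apply: lspan_scale.
by rewrite -opprB -scaleN1r; apply/lspan_scale/qreprP.
Qed.
Lemma qpiN u : qpi (- u) = qopp (qpi u).
Proof. by rewrite /qopp -!scaleN1r !qpiZ qreprK. Qed.

Lemma qaddA : associative qadd.
Proof.
by move=> x y z; rewrite -(qreprK x) -(qreprK y) -(qreprK z) -!qpiD addrA.
Qed.
Lemma qaddC : commutative qadd.
Proof. by move=> x y; rewrite /qadd addrC. Qed.
Lemma qadd0 : left_id (qpi 0) qadd.
Proof. by move=> x; rewrite -(qreprK x) -qpiD add0r. Qed.
Lemma qaddN : left_inverse (qpi 0) qopp qadd.
Proof. by move=> x; rewrite -(qreprK x) -qpiN -qpiD addNr. Qed.
HB.instance Definition _ :=
  GRing.isZmodule.Build quotient_space qaddA qaddC qadd0 qaddN.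

Lemma qscaleA a b x : qscale a (qscale b x) = qscale (a * b) x.
Proof. by rewrite -(qreprK x) -!qpiZ scalerA. Qed.
Lemma qscale1 : left_id 1 qscale.
Proof. by move=> x; rewrite -(qreprK x) -qpiZ scale1r. Qed.
Lemma qscaleDr : right_distributive qscale qadd.
Proof.
by move=> a x y; rewrite -(qreprK x) -(qreprK y) -qpiD -!qpiZ -qpiD scalerDr.
Qed.
Lemma qscaleDl (x : quotient_space) : {morph qscale^~ x : a b / a + b >-> qadd a b}.
Proof. by move=> a b /=; rewrite -(qreprK x) -!qpiZ -qpiD scalerDl. Qed.
HB.instance Definition _ :=
  GRing.Zmodule_isLmodule.Build K quotient_space
    qscaleA qscale1 qscaleDr qscaleDl.

End QuotientSpace.

(* Finite-dimensional modules over H_n(0) and supermodules over HCl_n(0).  A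
   module over an algebra given by generators and relations is a vector space
   with one operator per generator, subject to the relations.  As only
   isomorphism classes matter, the underlying space is K^d, which keeps the
   modules in a small type.  Operators are indexed from 1; those out of range
   are ignored by morphisms. *)

Record Hmod (K : fieldType) (n : nat) := HMod {
  hdim : nat;
  hpi : nat -> 'End('rV[K]_hdim);
  hpi_sq : forall i v, (0 < i < n)%N -> hpi i (hpi i v) = - hpi i v;
  hpi_comm : forall i j v, (0 < i < n)%N -> (0 < j < n)%N ->
    (i.+1 < j)%N || (j.+1 < i)%N -> hpi i (hpi j v) = hpi j (hpi i v);
  hpi_braid : forall i v, (0 < i)%N -> (i.+1 < n)%N ->
    hpi i (hpi i.+1 (hpi i v)) = hpi i.+1 (hpi i (hpi i.+1 v))
}.

Definition hcar (K : fieldType) n (M : Hmod K n) : vectType K := 'rV[K]_(hdim M).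
Coercion hcar : Hmod >-> Vector.type.

Arguments hpi {K n h} i.

Record HClmod (K : fieldType) (n : nat) := HClMod {
  restr :> Hmod K n;
  hc : nat -> 'End(restr);
  hdeg : bool -> {vspace restr};  (* false: even part, true: odd part *)
  hc_sq : forall i v, (0 < i <= n)%N -> hc i (hc i v) = - v;
  hc_anti : forall i j v, (0 < i <= n)%N -> (0 < j <= n)%N -> i != j ->
    hc i (hc j v) = - hc j (hc i v);
  hpi_hc : forall i j v, (0 < i < n)%N -> (0 < j <= n)%N ->
    j != i -> j != i.+1 -> hpi i (hc j v) = hc j (hpi i v);
  hpi_hc0 : forall i v, (0 < i < n)%N -> hpi i (hc i v) = hc i.+1 (hpi i v);
  hpi_hc1 : forall i v, (0 < i < n)%N ->
    hpi i (hc i.+1 v) + hc i.+1 v = hc i (hpi i v + v);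
  hdeg_sum : (hdeg false + hdeg true = fullv)%VS;
  hdeg_dir : (hdeg false :&: hdeg true = 0)%VS;
  hpi_deg : forall i b, (0 < i < n)%N -> (hpi i @: hdeg b <= hdeg b)%VS;
  hc_deg : forall i b, (0 < i <= n)%N -> (hc i @: hdeg b <= hdeg (~~ b))%VS
}.

Arguments hc {K n h} i.

Definition Hhom (K : fieldType) n (M N : Hmod K n) (f : 'Hom(M, N)) : Prop :=
  forall i v, (0 < i < n)%N -> f (hpi i v) = hpi i (f v).

Definition HClhom (K : fieldType) n (M N : HClmod K n) (f : 'Hom(M, N)) : Prop :=
  [/\ Hhom f, forall i v, (0 < i <= n)%N -> f (hc i v) = hc i (f v)
    & forall b, (f @: hdeg M b <= hdeg N b)%VS].

Definition short_exact (K : fieldType) (U V W : vectType K)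
    (f : 'Hom(U, V)) (g : 'Hom(V, W)) : Prop :=
  [/\ lker f = 0%VS, limg f = lker g & limg g = fullv].

Section ParityShift.
Variables (K : fieldType) (n : nat) (M : HClmod K n).

Lemma parity_sum : (hdeg M (~~ false) + hdeg M (~~ true) = fullv)%VS.
Proof. by rewrite addvC hdeg_sum. Qed.
Lemma parity_dir : (hdeg M (~~ false) :&: hdeg M (~~ true) = 0)%VS.
Proof. by rewrite capvC hdeg_dir. Qed.

Definition parity_shift : HClmod K n :=
  @HClMod K n (restr M) (@hc _ _ M) (fun b => hdeg M (~~ b))
    (@hc_sq _ _ M) (@hc_anti _ _ M) (@hpi_hc _ _ M) (@hpi_hc0 _ _ M)
    (@hpi_hc1 _ _ M) parity_sum parity_dir
    (fun i b => @hpi_deg _ _ M i (~~ b)) (fun i b => @hc_deg _ _ M i (~~ b)).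

End ParityShift.

(* Grothendieck groups have coefficients extended to the base field: over the
   integers the functions K_a span only a subgroup of finite index in the
   image of each graded piece under the peak characteristic. *)

Definition Hrelators (K : fieldType) n : set {malg K[{classic Hmod K n}]} :=
  [set x | exists (M' M M'' : Hmod K n) (f : 'Hom(M', M)) (g : 'Hom(M, M'')),
     [/\ Hhom f, Hhom g, short_exact f g
       & x = << M : {classic Hmod K n} >> - << M' : {classic Hmod K n} >>
             - << M'' : {classic Hmod K n} >>]].

Arguments Hrelators K n : clear implicits.

Definition G0H (K : fieldType) n : lmodType K := quotient_space (Hrelators K n).

Definition Hclass (K : fieldType) n (M : Hmod K n) : G0H K n :=
  qpi (Hrelators K n) << M : {classic Hmod K n} >>.

(* Isomorphisms of supermodules may be even or odd, so that a supermodule and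
   its parity shift have the same class. *)
Definition HClrelators (K : fieldType) n : set {malg K[{classic HClmod K n}]} :=
  [set x | exists (M' M M'' : HClmod K n) (f : 'Hom(M', M)) (g : 'Hom(M, M'')),
     [/\ HClhom f, HClhom g, short_exact f g
       & x = << M : {classic HClmod K n} >> - << M' : {classic HClmod K n} >>
             - << M'' : {classic HClmod K n} >>]]
  `|` [set x | exists M : HClmod K n,
         x = << M : {classic HClmod K n} >>
             - << parity_shift M : {classic HClmod K n} >>].

Arguments HClrelators K n : clear implicits.

Definition G0HCl (K : fieldType) n : lmodType K :=
  quotient_space (HClrelators K n).

Definition HClclass (K : fieldType) n (M : HClmod K n) : G0HCl K n :=
  qpi (HClrelators K n) << M : {classic HClmod K n} >>.

(* M, with iota : N -> M, is the supermodule induced from the H_n(0)-module N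
   (placed in even degree): induction is left adjoint to restriction. *)
Definition is_induced (K : fieldType) n (N : Hmod K n) (M : HClmod K n)
    (iota : 'Hom(N, M)) : Prop :=
  [/\ Hhom iota, (limg iota <= hdeg M false)%VS
    & forall (P : HClmod K n) (f : 'Hom(N, P)),
        Hhom f -> (limg f <= hdeg P false)%VS ->
        exists g : 'Hom(M, P),
          [/\ HClhom g, forall v, g (iota v) = f v
            & forall h : 'Hom(M, P), HClhom h ->
                (forall v, h (iota v) = f v) -> h = g]].

Section SimpleModule.
Variables (K : fieldType) (n : nat) (a : seq nat).

Definition simple_coef (i : nat) : K := if i \in Des a then -1 else 0.
Definition simple_pi (i : nat) : 'End('rV[K]_1) := linfun ( *:%R (simple_coef i)).

Lemma simple_piE i v : simple_pi i v = simple_coef i *: v.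
Proof. by rewrite lfunE. Qed.
Lemma simple_coef_sq i : simple_coef i * simple_coef i = - simple_coef i.
Proof. by rewrite /simple_coef; case: ifP; rewrite ?mulrNN ?mulr1 ?opprK ?mulr0 ?oppr0. Qed.
Lemma simple_sq i v : (0 < i < n)%N ->
  simple_pi i (simple_pi i v) = - simple_pi i v.
Proof. by rewrite !simple_piE scalerA simple_coef_sq scaleNr. Qed.
Lemma simple_comm i j v : (0 < i < n)%N -> (0 < j < n)%N ->
  (i.+1 < j)%N || (j.+1 < i)%N ->
  simple_pi i (simple_pi j v) = simple_pi j (simple_pi i v).
Proof. by rewrite !simple_piE !scalerA mulrC. Qed.
Lemma simple_braid i v : (0 < i)%N -> (i.+1 < n)%N ->
  simple_pi i (simple_pi i.+1 (simple_pi i v)) =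
  simple_pi i.+1 (simple_pi i (simple_pi i.+1 v)).
Proof.
move=> _ _; rewrite !simple_piE !scalerA mulrAC simple_coef_sq.
by rewrite (mulrAC (simple_coef i.+1)) simple_coef_sq !mulNr mulrC.
Qed.

Definition simple_module : Hmod K n :=
  @HMod K n 1 simple_pi simple_sq simple_comm simple_braid.

End SimpleModule.

(* Standard fillings of a diagram of n boxes.  The reading order numbers the
   boxes by 'I_n; the filling T : 'S_n puts the entry (T r).+1 in box r, so
   that T is its own reading word. *)

Definition rw n (T : 'S_n) : seq nat := [seq (T r).+1 | r <- enum 'I_n].

Definition adjacent_swap (n i : nat) : 'S_n :=
  match n with
  | 0 => 1%g
  | m.+1 => tperm (inord i.-1) (inord i)
  end.
Definition swap_entries n (i : nat) (T : 'S_n) : 'S_n :=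
  (T * adjacent_swap n i)%g.

Definition DesT n (T : 'S_n) : {fset nat} :=
  [fset i in iota 1 n.-1 | (index i.+1 (rw T) < index i (rw T))%N]%fset.

Definition ascent_in n (T : 'S_n) (r s : 'I_n) : bool :=
  (r < s)%N && (T s == (T r).+1 :> nat).

(* The ascent of T in positions (r, s) is (T r).+1, the entry of box r; it is
   nonattacking if swapping it with the next entry stays in TT. *)
Definition ascent_compatible n (TT : {set 'S_n}) : Prop :=
  forall (T T' : 'S_n) (r s : 'I_n), T \in TT -> T' \in TT ->
    ascent_in T r s -> ascent_in T' r s ->
    (swap_entries (T r).+1 T \in TT) = (swap_entries (T' r).+1 T' \in TT).

Section DiagramModule.
Variables (K : fieldType) (n : nat) (TT : {set 'S_n}).

Definition dg_basis (T : 'S_n) : 'rV[K]_#|TT| := \row_j (enum_val j == T)%:R.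

Definition dg_act (i : nat) (T : 'S_n) : 'rV[K]_#|TT| :=
  if i \in DesT T then - dg_basis T
  else if swap_entries i T \in TT then dg_basis (swap_entries i T) else 0.

Definition dg_fun (i : nat) (v : 'rV[K]_#|TT|) : 'rV[K]_#|TT| :=
  \sum_j v 0 j *: dg_act i (enum_val j).
Lemma dg_fun_linear i : linear (dg_fun i).
Proof.
move=> a u v; rewrite /dg_fun scaler_sumr -big_split /=.
by apply: eq_bigr => j _; rewrite !mxE scalerDl scalerA.
Qed.
HB.instance Definition _ i :=
  GRing.isLinear.Build K 'rV[K]_#|TT| 'rV[K]_#|TT| _ (dg_fun i) (dg_fun_linear i).
Definition dg_pi (i : nat) : 'End('rV[K]_#|TT|) := linfun (dg_fun i).

Lemma dg_basis_enum (j : 'I_#|TT|) : dg_basis (enum_val j) = delta_mx 0 j.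
Proof.
apply/rowP=> k; rewrite !mxE eqxx /=; congr (nat_of_bool _)%:R.
by apply/eqP/eqP => [/enum_val_inj|->].
Qed.

Lemma dg_piE i T : T \in TT -> dg_pi i (dg_basis T) = dg_act i T.
Proof.
move=> TTT; rewrite lfunE /= /dg_fun -[T](enum_rankK_in TTT TTT).
set k := enum_rank_in _ _; rewrite dg_basis_enum (bigD1 k) //= big1 => [|j jk].
  by rewrite !mxE !eqxx scale1r addr0.
by rewrite !mxE (negbTE jk) andbF scale0r.
Qed.

Lemma dg_ext (f g : 'End('rV[K]_#|TT|)) :
  (forall T, T \in TT -> f (dg_basis T) = g (dg_basis T)) -> f =1 g.
Proof.
move=> fg v; rewrite [v]row_sum_delta !linear_sum; apply: eq_bigr => j _.
by rewrite !linearZ -dg_basis_enum /= fg ?enum_valP.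
Qed.

End DiagramModule.

Section EntryPositions.
Variable n : nat.
Implicit Types (T : 'S_n) (i j k : nat).

Definition posT T k : nat := index k (rw T).

Lemma posT_entry T (r : 'I_n) : posT T (T r).+1 = r.
Proof.
rewrite /posT /rw (@index_map _ _ (fun r : 'I_n => (T r).+1)) ?index_enum_ord //.
by move=> x y [/val_inj/perm_inj].
Qed.

Lemma posTE T (k : 'I_n) : posT T k.+1 = (T^-1)%g k.
Proof. by rewrite -[RHS](posT_entry T) permKV. Qed.

Lemma posT_inj T i j : (0 < i <= n)%N -> (0 < j <= n)%N ->
  posT T i = posT T j -> i = j.
Proof.
case: i j => [|i] [|j] //= ilt jlt.
by rewrite (posTE T (Ordinal ilt)) (posTE T (Ordinal jlt)) => /val_inj/perm_inj [->].
Qed.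

Lemma adjacent_swapE i (k : 'I_n) : (0 < i < n)%N ->
  adjacent_swap n i k = (if k == i.-1 :> nat then i
                         else if k == i :> nat then i.-1 else k) :> nat.
Proof.
case: n k => [|m] k; first by case: k.
move=> /andP[i0 im]; have im' : (i.-1 < m.+1)%N by lia.
rewrite /adjacent_swap; case: tpermP => [->|->|] /=.
- by rewrite !inordK // eqxx.
- by rewrite !inordK // eqxx; case: eqP => // E; rewrite -E; lia.
- move=> /eqP k1 /eqP k2; rewrite ifN; last first.
    by apply: contra k1 => /eqP <-; rewrite inord_val.
  by rewrite ifN //; apply: contra k2 => /eqP <-; rewrite inord_val.
Qed.

Lemma adjacent_swapK i : (adjacent_swap n i)^-1%g = adjacent_swap n i.
Proof. by rewrite /adjacent_swap; case: n => [|m]; rewrite ?invg1 ?tpermV. Qed.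

Lemma posT_swap T i k : (0 < i < n)%N -> (0 < k <= n)%N ->
  posT (swap_entries i T) k =
  posT T (if k == i then i.+1 else if k == i.+1 then i else k).
Proof.
case: k => [|k] //= iP klt.
rewrite (posTE _ (Ordinal klt)) /swap_entries invMg permM adjacent_swapK.
rewrite -posTE adjacent_swapE //=; congr (posT T _).
by do ![case: eqP => /=]; lia.
Qed.

Lemma posT_ext T T' :
  (forall k, (0 < k <= n)%N -> posT T k = posT T' k) -> T = T'.
Proof.
move=> TT'; apply: invg_inj; apply/permP => k; apply: val_inj.
by rewrite /= -!posTE TT' //=.
Qed.

Lemma mem_DesT T i : (0 < i < n)%N -> (i \in DesT T) = (posT T i.+1 < posT T i)%N.
Proof.
move=> iP; rewrite !inE /= mem_iota; suff -> : (1 <= i < 1 + n.-1)%N by [].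
by case: n iP => [|m] /=; lia.
Qed.

Lemma swap_comm T i j : (0 < i < n)%N -> (0 < j < n)%N ->
  (i.+1 < j)%N || (j.+1 < i)%N ->
  swap_entries i (swap_entries j T) = swap_entries j (swap_entries i T).
Proof.
move=> iP jP ij; apply: posT_ext => k kP.
rewrite !posT_swap //; do ?[case: eqP => //]; lia.
Qed.

Lemma swap_braid T i : (0 < i)%N -> (i.+1 < n)%N ->
  swap_entries i (swap_entries i.+1 (swap_entries i T)) =
  swap_entries i.+1 (swap_entries i (swap_entries i.+1 T)).
Proof.
move=> i0 iP; apply: posT_ext => k kP.
rewrite !posT_swap //; do ?[case: eqP => //]; lia.
Qed.

End EntryPositions.

Section DiagramModuleRelations.
Variables (K : fieldType) (n : nat) (TT : {set 'S_n}).
Hypothesis compat : ascent_compatible TT.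
Implicit Types (T U : 'S_n) (i j : nat).

Definition nonattacking_at (p q : nat) : bool :=
  `[< exists T i, [/\ T \in TT, (0 < i < n)%N, (p < q)%N,
        posT T i = p /\ posT T i.+1 = q & swap_entries i T \in TT] >].

Lemma swap_mem T i : T \in TT -> (0 < i < n)%N -> (posT T i < posT T i.+1)%N ->
  (swap_entries i T \in TT) = nonattacking_at (posT T i) (posT T i.+1).
Proof.
move=> TTT iP asc; apply/idP/asboolP => [H|]; first by exists T, i.
move=> [U [j [UTT jP _ [p1 p2] memU]]].
have ent (V : 'S_n) l : (0 < l < n)%N -> exists r s : 'I_n,
   [/\ (V r).+1 = l, V s = l :> nat, posT V l = r & posT V l.+1 = s].
  move=> lP; have l1 : (l.-1 < n)%N by lia. have l2 : (l < n)%N by lia.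
  exists ((V^-1)%g (Ordinal l1)), ((V^-1)%g (Ordinal l2)).
  rewrite !permKV /= -!posTE /= prednK //; lia.
have [r [s [Tr Ts pr ps]]] := ent T i iP.
have [r' [s' [Ur Us pr' ps']]] := ent U j jP.
have rr : r = r' by apply: val_inj; rewrite /= -pr -pr' p1.
have ss : s = s' by apply: val_inj; rewrite /= -ps -ps' p2.
subst r' s'.
have := @compat T U r s TTT UTT; rewrite /ascent_in Tr Ur Ts Us !eqxx !andbT.
by rewrite -pr -ps asc => /(_ isT isT) ->.
Qed.

Lemma dg_piP T i : T \in TT -> (0 < i < n)%N ->
  dg_pi K TT i (dg_basis K TT T) =
  if (posT T i.+1 < posT T i)%N then - dg_basis K TT T
  else if nonattacking_at (posT T i) (posT T i.+1)
       then dg_basis K TT (swap_entries i T) else 0.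
Proof.
move=> TTT iP; rewrite dg_piE // /dg_act mem_DesT //.
case: (ltngtP (posT T i.+1) (posT T i)) => // [lt|/posT_inj E].
  by rewrite swap_mem.
by have : i.+1 = i by [apply: E; lia]; lia.
Qed.

Lemma swap_memP T i : T \in TT -> (0 < i < n)%N ->
  (posT T i < posT T i.+1)%N -> nonattacking_at (posT T i) (posT T i.+1) ->
  swap_entries i T \in TT.
Proof. by move=> TTT iP asc; rewrite swap_mem. Qed.

Lemma posT_total T i j : (0 < i <= n)%N -> (0 < j <= n)%N -> i != j ->
  (posT T i < posT T j)%N = true /\ (posT T j < posT T i)%N = false \/
  (posT T i < posT T j)%N = false /\ (posT T j < posT T i)%N = true.
Proof.
move=> iP jP /eqP ij; case: (ltngtP (posT T i) (posT T j)) => //.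
- by left.
- by right.
- by move=> /(posT_inj iP jP)/ij.
Qed.

Lemma swap0 i : (0 < i < n)%N ->
  forall T, posT (swap_entries i T) i = posT T i.+1.
Proof. by move=> iP T; rewrite posT_swap ?eqxx //; lia. Qed.
Lemma swap1 i : (0 < i < n)%N ->
  forall T, posT (swap_entries i T) i.+1 = posT T i.
Proof. by move=> iP T; rewrite posT_swap ?eqxx ?gtn_eqF //; lia. Qed.
Lemma swap2 i k : (0 < i < n)%N -> (0 < k <= n)%N -> k != i -> k != i.+1 ->
  forall T, posT (swap_entries i T) k = posT T k.
Proof. by move=> iP kP /negbTE k0 /negbTE k1 T; rewrite posT_swap // k0 k1. Qed.

Section Relations.
Variables (V : zmodType) (e : 'S_n -> V) (p : nat -> V -> V).
Hypothesis pN : forall i v, p i (- v) = - p i v.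
Hypothesis p0 : forall i, p i 0 = 0.
Hypothesis pP : forall T i, T \in TT -> (0 < i < n)%N ->
  p i (e T) = if (posT T i.+1 < posT T i)%N then - e T
              else if nonattacking_at (posT T i) (posT T i.+1)
                   then e (swap_entries i T) else 0.

Ltac bounds := solve [assumption | done | lia].
Ltac pos PR := rewrite ?PR.
Ltac member PR :=
  first [ assumption
        | apply: swap_memP; [member PR | bounds | pos PR; done | pos PR; done] ].
Ltac step PR := rewrite [p _ (e _)]pP;
  [ pos PR; repeat match goal with H : _ = _ :> bool |- _ => rewrite H end
  | member PR | bounds].
Ltac norm := rewrite ?pN ?p0 ?oppr0.
Ltac split_att := match goal with
  | |- context [if nonattacking_at ?a ?b then _ else _] =>
      let Y := fresh "Y" in case Y : (nonattacking_at a b) end.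
Ltac run PR := norm; repeat (first [split_att | step PR]; norm; try done).

Lemma rel_sq T i : T \in TT -> (0 < i < n)%N -> p i (p i (e T)) = - p i (e T).
Proof.
move=> TTT iP.
have PR := (swap0 iP, swap1 iP).
by have [] := @posT_total T i i.+1; try bounds; move=> [E1 E2]; run PR.
Qed.

Lemma rel_comm T i j : T \in TT -> (0 < i < n)%N -> (0 < j < n)%N ->
  (i.+1 < j)%N || (j.+1 < i)%N -> p i (p j (e T)) = p j (p i (e T)).
Proof.
move=> TTT iP jP ij.
have [P1 P2 P3 P4] : [/\ forall U, posT (swap_entries i U) j = posT U j,
    forall U, posT (swap_entries i U) j.+1 = posT U j.+1,
    forall U, posT (swap_entries j U) i = posT U i
  & forall U, posT (swap_entries j U) i.+1 = posT U i.+1].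
  by split; apply: swap2; lia.
have PR := (swap0 iP, swap1 iP, swap0 jP, swap1 jP, (P1, P2, P3, P4)).
have [] := @posT_total T i i.+1; try bounds; move=> [E1 E2];
have [] := @posT_total T j j.+1; try bounds; move=> [E3 E4];
run PR.
all: by rewrite swap_comm.
Qed.

Lemma rel_braid T i : T \in TT -> (0 < i)%N -> (i.+1 < n)%N ->
  p i (p i.+1 (p i (e T))) = p i.+1 (p i (p i.+1 (e T))).
Proof.
move=> TTT i0 iP; have iP1 : (0 < i < n)%N by lia.
have iP2 : (0 < i.+1 < n)%N by lia.
have [P1 P2] : (forall U, posT (swap_entries i U) i.+2 = posT U i.+2) /\
               (forall U, posT (swap_entries i.+1 U) i = posT U i).
  by split; apply: swap2; lia.
have PR := (swap0 iP1, swap1 iP1, swap0 iP2, swap1 iP2, (P1, P2)).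
have [] := @posT_total T i i.+1; try bounds; move=> [E1 E2];
have [] := @posT_total T i.+1 i.+2; try bounds; move=> [E3 E4];
have [] := @posT_total T i i.+2; try bounds; move=> [E5 E6]; try lia;
run PR.
all: by rewrite swap_braid.
Qed.

End Relations.

Lemma dg_piN i v : dg_pi K TT i (- v) = - dg_pi K TT i v.
Proof. exact: linearN. Qed.
Lemma dg_pi0 i : dg_pi K TT i 0 = 0.
Proof. exact: linear0. Qed.

Lemma dg_sq i v : (0 < i < n)%N ->
  dg_pi K TT i (dg_pi K TT i v) = - dg_pi K TT i v.
Proof.
move=> iP; rewrite -comp_lfunE -opp_lfunE; apply: dg_ext => T TTT.
rewrite comp_lfunE opp_lfunE.
exact: (rel_sq dg_piN dg_pi0 dg_piP TTT iP).
Qed.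

Lemma dg_comm i j v : (0 < i < n)%N -> (0 < j < n)%N ->
  (i.+1 < j)%N || (j.+1 < i)%N ->
  dg_pi K TT i (dg_pi K TT j v) = dg_pi K TT j (dg_pi K TT i v).
Proof.
move=> iP jP ij; rewrite -!comp_lfunE; apply: dg_ext => T TTT.
rewrite !comp_lfunE; exact: (rel_comm dg_piN dg_pi0 dg_piP TTT iP jP ij).
Qed.

Lemma dg_braid i v : (0 < i)%N -> (i.+1 < n)%N ->
  dg_pi K TT i (dg_pi K TT i.+1 (dg_pi K TT i v)) =
  dg_pi K TT i.+1 (dg_pi K TT i (dg_pi K TT i.+1 v)).
Proof.
move=> i0 iP; rewrite -!comp_lfunE; apply: dg_ext => T TTT.
rewrite !comp_lfunE; exact: (rel_braid dg_piN dg_pi0 dg_piP TTT i0 iP).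
Qed.

Definition diagram_module : Hmod K n :=
  @HMod K n #|TT| (dg_pi K TT) dg_sq dg_comm dg_braid.

End DiagramModuleRelations.

Definition is_strict_partition (n : nat) (lambda : seq nat) : bool :=
  [&& sorted gtn lambda, all (fun k => 0 < k)%N lambda & sumn lambda == n].

(* The boxes (row, column), in reading order: top row first *)
Definition ShD (lambda : seq nat) : seq (nat * nat) :=
  flatten [seq [seq (i, j) | j <- iota i (nth 0%N lambda i.-1)]
          | i <- rev (iota 1 (size lambda))].

Definition must_increase (lambda : seq nat) (r s : nat) : bool :=
  let b := nth (0, 0)%N (ShD lambda) in
  ((b r).1 == (b s).1) && ((b r).2 < (b s).2)%N
  || ((b r).2 == (b s).2) && ((b r).1 < (b s).1)%N.

Definition SShT (n : nat) (lambda : seq nat) : {set 'S_n} :=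
  [set T : 'S_n | [forall r : 'I_n, forall s : 'I_n,
                     must_increase lambda r s ==> (T r < T s)%N]].

Lemma SShT_compatible n lambda : ascent_compatible (SShT n lambda).
Proof.
suff nonatt (T : 'S_n) (r s : 'I_n) : T \in SShT n lambda -> ascent_in T r s ->
    (swap_entries (T r).+1 T \in SShT n lambda) = ~~ must_increase lambda r s.
  by move=> T T' r s TS TS' a a'; rewrite !(nonatt _ r s).
rewrite !inE => /forallP TS /andP[rs /eqP Ts].
have iP : (0 < (T r).+1 < n)%N by have := ltn_ord (T s); rewrite Ts.
have Tr_s u : T u = T r :> nat -> u = r by move=> /val_inj/perm_inj.
have Ts_s u : T u = (T r).+1 :> nat -> u = s.
  by rewrite -Ts => /val_inj/perm_inj.
have inc (u v : 'I_n) : must_increase lambda u v -> (T u < T v)%N.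
  by move=> uv; have /forallP/(_ v)/implyP := TS u; apply.
have swE (u : 'I_n) : swap_entries (T r).+1 T u = (if T u == T r :> nat then (T r).+1
    else if T u == (T r).+1 :> nat then T r : nat else T u) :> nat.
  by rewrite /swap_entries permM adjacent_swapE.
apply/forallP/idP => [H|nrs u].
  apply/negP => Rrs; have /forallP/(_ s)/implyP/(_ Rrs) := H r.
  by rewrite !swE Ts !eqxx gtn_eqF // ltnNge leqnSn.
apply/forallP => v; apply/implyP => uv; have uvT := inc _ _ uv.
have nuv : ~ (T u = T r :> nat /\ T v = (T r).+1 :> nat).
  by move=> [/Tr_s Eu /Ts_s Ev]; move: nrs; rewrite -Eu -Ev uv.
by rewrite !swE; do ![case: eqP => ? //]; lia.
Qed.

Definition SShT_module (K : fieldType) n (lambda : seq nat) : Hmod K n :=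
  diagram_module K (@SShT_compatible n lambda).

Definition schurQ (K : fieldType) (n : nat) (lambda : seq nat) : series K :=
  \sum_(S in SShT n lambda) Kfun K n (comp_of_set n (Peak (DesT S))).


(* The isomorphism of the direct sum over n is given degree by degree. *)
Definition is_quasisymmetric_characteristic (K : fieldType)
    (ch : forall n, {linear G0H K n -> series K}) : Prop :=
  [/\ forall n, injective (ch n),
      forall n, range (ch n) = @QSym K n
    & forall n (a : composition n),
        ch n (Hclass (simple_module K n a)) = Ffun K a].

Definition is_peak_characteristic (K : fieldType)
    (cht : forall n, {linear G0HCl K n -> series K}) : Prop :=
  [/\ forall n, injective (cht n),
      forall n, range (cht n) = @PeakAlg K n
    & forall n (a : composition n) (M : HClmod K n)
        (iota : 'Hom(simple_module K n a, M)), is_induced iota ->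
        cht n (HClclass M) = Kfun K n (comp_of_set n (Peak (Des a)))].

(* Main.v *)
Require Import Defs.
From HB Require Import structures.
From mathcomp Require Import all_boot all_order all_fingroup all_algebra.
From mathcomp Require Import classical_sets functions reals complex.
From mathcomp Require Import boolp zify ring finmap.
Import GRing.Theory.
Local Open Scope ring_scope.

Set Implicit Arguments.
Unset Strict Implicit.
Unset Printing Implicit Defensive.

(* A nonattacking swap [T -> s_i T] strictly decreases the weight
   [sum_k k * (position of the entry k+1)].  Hence, if [T0] has the largest
   weight in an ascent-compatible set, the other fillings span a submodule,
   which is again a diagram module, and the quotient is the simple module of
   [Des(T0)].  By induction, every function of H_n(0)-modules that is additive
   on short exact sequences takes on the diagram module the sum of its values
   on the simple modules of the [Des(T)].  The first identity is the case of
   the class in the Grothendieck group.  The second one is the case of the class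
   of the induced supermodule, for which one needs that induction is exact: as a
   vector space, the supermodule induced from [N] is the tensor product of the
   Clifford algebra with [N], with an explicit action of the generators. *)

(** * Linearity of homomorphisms, as rewriting rules *)

Section HomLinearity.
Variables (K : fieldType) (U V : vectType K) (f : 'Hom(U, V)).

Lemma homD u v : f (u + v) = f u + f v. Proof. exact: linearD. Qed.
Lemma homN u : f (- u) = - f u. Proof. exact: linearN. Qed.
Lemma homZ a u : f (a *: u) = a *: f u. Proof. exact: linearZ. Qed.
Lemma hom0 : f 0 = 0. Proof. exact: linear0. Qed.

End HomLinearity.

(** * Subsets of [n] indexing the Clifford products: bits, toggles, parities *)

Section Subsets.
Variable n : nat.
Implicit Types (D E : {set 'I_n}) (i j k : nat).

(** Generators are numbered from 1 and elements of ['I_n] from 0, hence the shift. Out of range,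
    [bit] is false and [toggle] is the identity. *)
Definition bit k D : bool := [exists r in D, r.+1 == k].
Definition toggle k D : {set 'I_n} :=
  [set r : 'I_n | (r \in D) (+) (r.+1 == k)].
(** Besides [D] itself, this is the only index set that can appear when [pi_i] is moved past
    [c_D]. *)
Definition toggle2 i D : {set 'I_n} := toggle i (toggle i.+1 D).
(** This gives the sign in [c_j c_D = (-1)^(parity j D) c_(toggle j D)]: one factor -1 for each
    element of [D] below [j] that [c_j] passes, and one from [c_j^2 = -1] if [j] is in [D]. For
    [j = n] it is the degree of [c_D]. *)
Definition parity j D : bool := odd (count (fun k => bit k D) (iota 1 j)).

Lemma bit_ord (r : 'I_n) D : bit r.+1 D = (r \in D).
Proof.
apply/existsP/idP => [[s /andP[sD /eqP[/val_inj <-]]] //|rD].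
by exists r; rewrite rD eqxx.
Qed.

Lemma bitP k : (0 < k <= n)%N -> exists r : 'I_n, k = r.+1.
Proof. by case: k => // k kn; exists (Ordinal kn). Qed.

Lemma bit_toggle k j D : (0 < k <= n)%N ->
  bit k (toggle j D) = bit k D (+) (k == j).
Proof. by move=> /bitP[r ->]; rewrite !bit_ord inE. Qed.

Lemma bit_set0 k : bit k finset.set0 = false.
Proof. by apply/existsP => -[r]; rewrite inE. Qed.

Lemma toggleK k : involutive (toggle k).
Proof. by move=> D; apply/setP => r; rewrite !inE addbK. Qed.

Lemma toggleC j k D : toggle j (toggle k D) = toggle k (toggle j D).
Proof. by apply/setP => r; rewrite !inE -!addbA (addbC (_ == j)). Qed.

Lemma toggle2K i : involutive (toggle2 i).
Proof. by move=> D; rewrite /toggle2 (toggleC i.+1 i) !toggleK. Qed.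

Lemma toggle2C i j D : toggle2 i (toggle2 j D) = toggle2 j (toggle2 i D).
Proof.
rewrite /toggle2 (toggleC i.+1 j) (toggleC i j) (toggleC i.+1 j.+1).
by rewrite (toggleC i j.+1).
Qed.

Lemma toggle_toggle2 j i D : toggle j (toggle2 i D) = toggle2 i (toggle j D).
Proof. by rewrite /toggle2 (toggleC j i) (toggleC j i.+1). Qed.

Lemma toggle2_toggle i D : toggle2 i (toggle i D) = toggle i.+1 D.
Proof. by rewrite /toggle2 (toggleC i.+1) toggleK. Qed.

Lemma toggle2_toggleS i D : toggle2 i (toggle i.+1 D) = toggle i D.
Proof. by rewrite /toggle2 toggleK. Qed.

Lemma bit_toggle2 k i D : (0 < k <= n)%N ->
  bit k (toggle2 i D) = bit k D (+) ((k == i) || (k == i.+1)).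
Proof.
move=> kn; rewrite !bit_toggle // -addbA; congr addb.
by do ![case: eqP => //]; lia.
Qed.

Lemma parityS j D : parity j.+1 D = parity j D (+) bit j.+1 D.
Proof.
by rewrite /parity -(addn1 j) iotaD count_cat oddD /= addn0 oddb add1n addn1.
Qed.

Lemma parity_toggle j k D : (0 < k)%N -> (j <= n)%N ->
  parity j (toggle k D) = parity j D (+) (k <= j)%N.
Proof.
move=> k0; elim: j => [|j IH] jn; first by rewrite leqNgt k0.
rewrite !parityS IH ?bit_toggle //; last by lia.
rewrite -!addbA; congr addb; rewrite addbCA; congr addb; lia.
Qed.

Lemma parity_toggle2 j i D : (0 < i)%N -> (j <= n)%N ->
  parity j (toggle2 i D) = parity j D (+) (j == i).
Proof.
move=> i0 jn; rewrite !parity_toggle // -addbA; congr addb; lia.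
Qed.

End Subsets.

(** * Relations of HCl_n(0) for the explicit operators on families *)

Section InducedOperators.
Variables (K : fieldType) (n d : nat).
Local Notation W := 'rV[K]_d.
Implicit Types (F : {set 'I_n} -> W) (A B : 'End(W)) (D : {set 'I_n}).

(* With [c_D] the product of the [c_k], [k] in [D], in increasing order, [F]
   stands for [sum_D c_D (x) F D], and [A] for the action of [pi_i] on the
   second factor; [ind_pi] and [ind_c] move [pi_i] and [c_j] past the products [c_D]. *)
Definition ind_pi A i F D : W :=
  if bit i D then
    if bit i.+1 D then - (A (F D) + F D)
    else A (F (toggle2 i D)) + F (toggle2 i D)
  else if bit i.+1 D then A (F (toggle2 i D)) - F D
  else A (F D) + F (toggle2 i D).

Definition ind_c j F D : W := (-1) ^+ (~~ parity j D) *: F (toggle j D).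

Ltac coordinates := apply/rowP => z; rewrite !mxE; ring.

(** Since [toggle2 i] is an involution flipping both bits, each of the four cases involves only the
    values of [F] at [D] and [toggle2 i D]. By linearity of [A] the claim becomes an identity of
    vectors, checked entrywise. *)
Lemma ind_pi_sq A i F D : (forall v, A (A v) = - A v) -> (0 < i < n)%N ->
  ind_pi A i (ind_pi A i F) D = - ind_pi A i F D.
Proof.
move=> AA iP; rewrite /ind_pi !toggle2K !bit_toggle2 ?eqxx ?orbT; try lia.
by case: (bit i D); case: (bit i.+1 D) => /=; rewrite ?(homD, homN, AA) /=;
  coordinates.
Qed.

Lemma ind_pi_comm A B i j F D : (forall v, A (B v) = B (A v)) ->
  (0 < i < n)%N -> (0 < j < n)%N -> (i.+1 < j)%N || (j.+1 < i)%N ->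
  ind_pi A i (ind_pi B j F) D = ind_pi B j (ind_pi A i F) D.
Proof.
move=> AB iP jP ij.
have [E1 E2 E3 E4] : [/\ bit i (toggle2 j D) = bit i D,
  bit i.+1 (toggle2 j D) = bit i.+1 D, bit j (toggle2 i D) = bit j D
  & bit j.+1 (toggle2 i D) = bit j.+1 D].
  by split; rewrite bit_toggle2; try lia; rewrite -[RHS]addbF; congr addb;
    apply/negbTE; lia.
rewrite /ind_pi (toggle2C j i) E1 E2 E3 E4.
by case: (bit i D); case: (bit i.+1 D); case: (bit j D);
  case: (bit j.+1 D) => /=;
  rewrite ?(homD, homN, AB) /=; coordinates.
Qed.

(** The two toggles are commuting involutions, so each of the eight cases involves at most four
    values of [F]. The terms without [A] or [B] in the operators produce shorter words, which is
    where the quadratic relations enter. *)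
Lemma ind_pi_braid A B i F D : (forall v, A (A v) = - A v) ->
  (forall v, B (B v) = - B v) -> (forall v, A (B (A v)) = B (A (B v))) ->
  (0 < i)%N -> (i.+1 < n)%N ->
  ind_pi A i (ind_pi B i.+1 (ind_pi A i F)) D =
  ind_pi B i.+1 (ind_pi A i (ind_pi B i.+1 F)) D.
Proof.
move=> AA BB ABA i0 iP.
have B1 (E : {set 'I_n}) : bit i (toggle2 i E) = ~~ bit i E.
  by rewrite bit_toggle2 ?eqxx /= ?addbT //; lia.
have B2 (E : {set 'I_n}) : bit i.+1 (toggle2 i E) = ~~ bit i.+1 E.
  by rewrite bit_toggle2 ?eqxx ?orbT ?addbT //; lia.
have B3 (E : {set 'I_n}) : bit i.+2 (toggle2 i E) = bit i.+2 E.
  by rewrite bit_toggle2; last lia; rewrite -[RHS]addbF; congr addb; lia.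
have B4 (E : {set 'I_n}) : bit i (toggle2 i.+1 E) = bit i E.
  by rewrite bit_toggle2; last lia; rewrite -[RHS]addbF; congr addb; lia.
have B5 (E : {set 'I_n}) : bit i.+1 (toggle2 i.+1 E) = ~~ bit i.+1 E.
  by rewrite bit_toggle2 ?eqxx /= ?addbT //; lia.
have B6 (E : {set 'I_n}) : bit i.+2 (toggle2 i.+1 E) = ~~ bit i.+2 E.
  by rewrite bit_toggle2 ?eqxx ?orbT ?addbT //; lia.
rewrite /ind_pi !(B1, B2, B3, B4, B5, B6).
case: (bit i D); case: (bit i.+1 D); case: (bit i.+2 D) => /=;
  rewrite ?(toggle2K, toggle2C i.+1 i) ?(homD, homN, AA, BB, ABA); coordinates.
Qed.

(** The coefficient at [D] comes from [toggle j D], whose parity up to [j] is opposite to that of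
    [D]; this explains the negation in [ind_c] and makes the two signs multiply to -1. *)
Lemma ind_c_sq j F D : (0 < j <= n)%N -> ind_c j (ind_c j F) D = - F D.
Proof.
move=> jP; rewrite /ind_c scalerA -signr_addb toggleK parity_toggle; try lia.
by rewrite leqnn addbT negbK addNb addbb scaleN1r.
Qed.

Lemma ind_c_anti i j F D : (0 < i <= n)%N -> (0 < j <= n)%N -> i != j ->
  ind_c i (ind_c j F) D = - ind_c j (ind_c i F) D.
Proof.
move=> iP jP ij; rewrite /ind_c !scalerA -!signr_addb toggleC !parity_toggle;
  try lia.
rewrite -scaleNr; congr (_ *: _).
have -> : (j <= i)%N = ~~ (i <= j)%N by lia.
by case: (parity i D); case: (parity j D); case: leqP => _ /=; rewrite ?opprK.
Qed.

Lemma ind_pi_c A i j F D : (0 < i < n)%N -> (0 < j <= n)%N ->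
  j != i -> j != i.+1 -> ind_pi A i (ind_c j F) D = ind_c j (ind_pi A i F) D.
Proof.
move=> iP jP ji jSi; rewrite /ind_pi /ind_c !toggle_toggle2 parity_toggle2;
  try lia.
rewrite !bit_toggle; try lia.
rewrite (negbTE ji) !(eq_sym _ j) (negbTE ji) (negbTE jSi) !addbF.
by case: (bit i D); case: (bit i.+1 D); rewrite ?homZ -?scaleNr; coordinates.
Qed.

Lemma ind_pi_c0 A i F D : (0 < i < n)%N ->
  ind_pi A i (ind_c i F) D = ind_c i.+1 (ind_pi A i F) D.
Proof.
move=> iP; rewrite /ind_pi /ind_c !toggle_toggle2 parity_toggle2; try lia.
rewrite !toggle2_toggle !toggle2_toggleS !bit_toggle; try lia.
rewrite !eqxx parityS ?(gtn_eqF (ltnSn i)) ?(ltn_eqF (ltnSn i)).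
case: (bit i D); case: (bit i.+1 D); case: (parity i D) => /=;
 rewrite ?homZ; coordinates.
Qed.

Lemma ind_pi_c1 A i F D : (0 < i < n)%N ->
  ind_pi A i (ind_c i.+1 F) D + ind_c i.+1 F D =
  ind_c i (fun E => ind_pi A i F E + F E) D.
Proof.
move=> iP; rewrite /ind_pi /ind_c !toggle_toggle2 parity_toggle2; try lia.
rewrite !toggle2_toggle !toggle2_toggleS !bit_toggle; try lia.
rewrite !eqxx parityS ?(gtn_eqF (ltnSn i)) ?(ltn_eqF (ltnSn i)).
case: (bit i D); case: (bit i.+1 D); case: (parity i D) => /=;
 rewrite ?homZ; coordinates.
Qed.

End InducedOperators.

(** Packs a proof of linearity on the spot, without declaring an instance for each function. *)
Definition lfun_of (K : fieldType) (U V : vectType K) (f : U -> V)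
    (lin : linear f) : 'Hom(U, V) :=
  linfun (HB.pack_for {linear U -> V} f (GRing.isLinear.Build K U V _ f lin)).

Lemma lfun_ofE (K : fieldType) (U V : vectType K) (f : U -> V)
  (lin : linear f) u :
  lfun_of lin u = f u.
Proof. by rewrite /lfun_of lfunE. Qed.

Section LocalCoefficients.
Variables (K : fieldType) (n d : nat) (A : 'End('rV[K]_d)).
Implicit Types (D : {set 'I_n}) (v : 'rV[K]_d).

(* [pi_i c_D v = c_D (stay i D v) + c_(toggle2 i D) (jump i D v)] *)
Definition stay (i : nat) D v : 'rV[K]_d :=
  if bit i D then if bit i.+1 D then - (A v + v) else 0
  else if bit i.+1 D then - v else A v.
Definition jump (i : nat) D v : 'rV[K]_d :=
  if bit i D then if bit i.+1 D then v else A v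
  else if bit i.+1 D then A v + v else 0.

(** Collects by target: the coefficient at [D] receives [stay] from [D] and [jump] from
    [toggle2 i D]. *)
Lemma ind_piE i (F : {set 'I_n} -> 'rV[K]_d) D : (0 < i < n)%N ->
  ind_pi A i F D = stay i D (F D) + jump i (toggle2 i D) (F (toggle2 i D)).
Proof.
move=> iP; rewrite /ind_pi /stay /jump !bit_toggle2 ?eqxx ?orbT ?addbT; try lia.
by case: (bit i D); case: (bit i.+1 D); rewrite /= ?addr0 ?add0r // addrC.
Qed.

Lemma stay_linear i D : linear (stay i D).
Proof.
move=> a u v; rewrite /stay; case: (bit i D); case: (bit i.+1 D);
  rewrite ?homD ?homZ; apply/rowP => z; rewrite !mxE; ring.
Qed.

Lemma jump_linear i D : linear (jump i D).
Proof.
move=> a u v; rewrite /jump; case: (bit i D); case: (bit i.+1 D);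
  rewrite ?homD ?homZ; apply/rowP => z; rewrite !mxE; ring.
Qed.

Lemma stay0 i D : stay i D 0 = 0.
Proof. by rewrite /stay linear0 addr0 oppr0 !if_same. Qed.

Lemma jump0 i D : jump i D 0 = 0.
Proof. by rewrite /jump linear0 addr0 !if_same. Qed.

Lemma ind_pi_linear i a (F G : {set 'I_n} -> 'rV[K]_d) D : (0 < i < n)%N ->
  ind_pi A i (fun E => a *: F E + G E) D = a *: ind_pi A i F D + ind_pi A i G D.
Proof.
by move=> iP; rewrite !ind_piE // stay_linear jump_linear scalerDr addrACA.
Qed.

End LocalCoefficients.

(** * Families indexed by subsets as row vectors, and the induced supermodule *)

Section Families.
Variables (K : fieldType) (n d : nat).
Local Notation W := 'rV[K]_d.
Local Notation E := 'rV[K]_(#|{set 'I_n}| * d).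

(** Modules must live on some [K^d]; a vector of length [2^n * d] is read as a matrix with one row
    per subset. The row at [D] is the coefficient of [c_D], and [mono D v] is [c_D (x) v]. *)
Definition ccoef (x : E) (D : {set 'I_n}) : W := row (enum_rank D) (vec_mx x).
Definition of_ccoef (F : {set 'I_n} -> W) : E :=
  mxvec (\matrix_k F (enum_val k)).
Definition mono (D : {set 'I_n}) (v : W) : E :=
  of_ccoef (fun D' => if D' == D then v else 0).

Lemma ccoefK F : ccoef (of_ccoef F) = F.
Proof. by apply/funext => D; rewrite /ccoef mxvecK rowK enum_rankK. Qed.

Lemma ccoef_inj x y : ccoef x = ccoef y -> x = y.
Proof.
move=> xy; apply: (can_inj vec_mxK); apply/row_matrixP => k.
by have := congr1 (@^~ (enum_val k)) xy; rewrite /ccoef /= enum_valK.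
Qed.

Lemma ccoefD x y : ccoef (x + y) = fun D => ccoef x D + ccoef y D.
Proof. by apply/funext => D; rewrite /ccoef !linearD. Qed.
Lemma ccoefN x : ccoef (- x) = fun D => - ccoef x D.
Proof. by apply/funext => D; rewrite /ccoef !linearN. Qed.
Lemma ccoefZ a x : ccoef (a *: x) = fun D => a *: ccoef x D.
Proof. by apply/funext => D; rewrite /ccoef !linearZ. Qed.
Lemma ccoef0 : ccoef 0 = fun=> 0.
Proof. by apply/funext => D; rewrite /ccoef !linear0. Qed.

Lemma sum_mono x : x = \sum_D mono D (ccoef x D).
Proof.
apply: ccoef_inj; apply/funext => D.
rewrite {2}/ccoef !linear_sum /= (bigD1 D) //= big1 => [|D' /negbTE D'D].
  by rewrite addr0 -/(ccoef _ D) /mono ccoefK eqxx.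
by rewrite -/(ccoef _ D) /mono ccoefK eq_sym D'D.
Qed.

End Families.

Section InducedModule.
Variables (K : fieldType) (n : nat) (N : Hmod K n).
Local Notation E := 'rV[K]_(#|{set 'I_n}| * hdim N).
Local Notation W := 'rV[K]_(hdim N).

(** Out of range the operator is set to 0, a value that no relation or morphism sees;
    [ind_pi_linear] covers the range. *)
Definition ind_hpi_fun (i : nat) (x : E) : E :=
  if (0 < i < n)%N then of_ccoef (ind_pi (hpi i : 'End(W)) i (ccoef x)) else 0.
Definition ind_hc_fun (i : nat) (x : E) : E := of_ccoef (ind_c i (ccoef x)).
Definition ind_proj_fun (b : bool) (x : E) : E :=
  of_ccoef (fun D => if parity n D == b then ccoef x D else 0).

Lemma ind_hpi_linear i : linear (ind_hpi_fun i).
Proof.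
move=> a x y; rewrite /ind_hpi_fun; case: ifP => iP;
  last by rewrite scaler0 addr0.
apply: ccoef_inj; rewrite ccoefD ccoefZ !ccoefK ccoefD ccoefZ.
by apply/funext => D; rewrite ?ccoefK ind_pi_linear.
Qed.

Lemma ind_hc_linear i : linear (ind_hc_fun i).
Proof.
move=> a x y; apply: ccoef_inj; rewrite ccoefD ccoefZ !ccoefK ccoefD ccoefZ.
by apply/funext => D; rewrite ?ccoefK /ind_c scalerDr !scalerA mulrC.
Qed.

Lemma ind_proj_linear b : linear (ind_proj_fun b).
Proof.
move=> a x y; apply: ccoef_inj; rewrite ccoefD ccoefZ !ccoefK ccoefD ccoefZ.
by apply/funext => D; rewrite ?ccoefK; case: ifP => // _; rewrite scaler0 addr0.
Qed.

Definition ind_hpi i : 'End(E) := lfun_of (ind_hpi_linear i).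
Definition ind_hc i : 'End(E) := lfun_of (ind_hc_linear i).
(** Taken as the kernel of the projection to the other degree, so that membership means vanishing of
    coefficients. *)
Definition ind_deg b : {vspace E} := lker (lfun_of (ind_proj_linear (~~ b))).

Lemma ccoef_hpi i x : (0 < i < n)%N ->
  ccoef (ind_hpi i x) = ind_pi (hpi i : 'End(W)) i (ccoef x).
Proof. by move=> iP; rewrite lfun_ofE /ind_hpi_fun iP ccoefK. Qed.

Lemma ccoef_hc i x : ccoef (ind_hc i x) = ind_c i (ccoef x).
Proof. by rewrite lfun_ofE ccoefK. Qed.

Lemma ind_degP b x :
  reflect (forall D, parity n D != b -> ccoef x D = 0) (x \in ind_deg b).
Proof.
rewrite memv_ker lfun_ofE; apply: (iffP eqP) => [x0 D Db|x0].
  have := congr1 (@^~ D) (congr1 (@ccoef K n _) x0).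
  by rewrite ccoefK ccoef0 ifT //; move: Db; case: b (parity n D) {x0} => [] [].
apply: ccoef_inj; rewrite ccoefK ccoef0; apply/funext => D; case: eqP => // Db.
by apply: x0; rewrite Db; case: b {Db}.
Qed.

Lemma ind_hpi_sq i v : (0 < i < n)%N -> ind_hpi i (ind_hpi i v) = - ind_hpi i v.
Proof.
move=> iP; apply: ccoef_inj; rewrite ccoefN !ccoef_hpi //; apply/funext => D.
by rewrite ind_pi_sq // => w; exact: hpi_sq.
Qed.

Lemma ind_hpi_comm i j v : (0 < i < n)%N -> (0 < j < n)%N ->
  (i.+1 < j)%N || (j.+1 < i)%N -> ind_hpi i (ind_hpi j v) = ind_hpi j (ind_hpi
    i v).
Proof.
move=> iP jP ij; apply: ccoef_inj; rewrite !ccoef_hpi //; apply/funext => D.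
by rewrite ind_pi_comm // => w; exact: hpi_comm.
Qed.

Lemma ind_hpi_braid i v : (0 < i)%N -> (i.+1 < n)%N ->
  ind_hpi i (ind_hpi i.+1 (ind_hpi i v)) = ind_hpi i.+1 (ind_hpi i (ind_hpi
    i.+1 v)).
Proof.
move=> i0 iP; have iP1 : (0 < i < n)%N by lia.
apply: ccoef_inj; rewrite !ccoef_hpi //; apply/funext => D.
by rewrite ind_pi_braid // => w; [exact: hpi_sq|exact: hpi_sq|exact: hpi_braid].
Qed.

Definition ind_Hmod : Hmod K n :=
  @HMod K n (#|{set 'I_n}| * hdim N) ind_hpi ind_hpi_sq ind_hpi_comm
    ind_hpi_braid.

Lemma ind_hc_sq i v : (0 < i <= n)%N -> ind_hc i (ind_hc i v) = - v.
Proof.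
move=> iP; apply: ccoef_inj; rewrite ccoefN !ccoef_hc; apply/funext => D.
exact: ind_c_sq.
Qed.

Lemma ind_hc_anti i j v : (0 < i <= n)%N -> (0 < j <= n)%N -> i != j ->
  ind_hc i (ind_hc j v) = - ind_hc j (ind_hc i v).
Proof.
move=> iP jP ij; apply: ccoef_inj; rewrite ccoefN !ccoef_hc; apply/funext => D.
exact: ind_c_anti.
Qed.

Lemma ind_hpi_hc i j v : (0 < i < n)%N -> (0 < j <= n)%N ->
  j != i -> j != i.+1 -> ind_hpi i (ind_hc j v) = ind_hc j (ind_hpi i v).
Proof.
move=> iP jP ji jSi; apply: ccoef_inj; rewrite ccoef_hc !ccoef_hpi // ccoef_hc.
by apply/funext => D; exact: ind_pi_c.
Qed.

Lemma ind_hpi_hc0 i v : (0 < i < n)%N ->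
  ind_hpi i (ind_hc i v) = ind_hc i.+1 (ind_hpi i v).
Proof.
move=> iP; apply: ccoef_inj; rewrite ccoef_hc !ccoef_hpi // ccoef_hc.
by apply/funext => D; exact: ind_pi_c0.
Qed.

Lemma ind_hpi_hc1 i v : (0 < i < n)%N ->
  ind_hpi i (ind_hc i.+1 v) + ind_hc i.+1 v = ind_hc i (ind_hpi i v + v).
Proof.
move=> iP; apply: ccoef_inj; rewrite ccoefD !ccoef_hc ccoefD !ccoef_hpi //
  ccoef_hc.
by apply/funext => D; exact: ind_pi_c1.
Qed.

Lemma ind_deg_sum : (ind_deg false + ind_deg true = fullv)%VS.
Proof.
apply/eqP; rewrite eqEsubv subvf; apply/subvP => x _.
apply/memv_addP; exists (ind_proj_fun false x).
  by apply/ind_degP => D /negbTE Db; rewrite ccoefK Db.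
exists (ind_proj_fun true x).
  by apply/ind_degP => D /negbTE Db; rewrite ccoefK Db.
apply: ccoef_inj; rewrite ccoefD !ccoefK; apply/funext => D.
by case: (parity n D) => /=; rewrite ?addr0 ?add0r.
Qed.

Lemma ind_deg_dir : (ind_deg false :&: ind_deg true = 0)%VS.
Proof.
apply/eqP; rewrite -subv0; apply/subvP => x /memv_capP[/ind_degP x0 /ind_degP
  x1].
rewrite memv0; apply/eqP; apply: ccoef_inj; rewrite ccoef0; apply/funext => D.
by case E: (parity n D); [apply: x0|apply: x1]; rewrite E.
Qed.

Lemma parity_full_toggle j (D : {set 'I_n}) : (0 < j <= n)%N ->
  parity n (toggle j D) = ~~ parity n D.
Proof. by case/andP => j0 jn; rewrite parity_toggle // jn addbT. Qed.

(** [D] and [toggle2 i D] have cardinalities of the same parity, so both terms of [ind_piE] stay in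
    the same degree. *)
Lemma ind_hpi_deg i b : (0 < i < n)%N ->
  (ind_hpi i @: ind_deg b <= ind_deg b)%VS.
Proof.
move=> iP; apply/subvP => _ /memv_imgP[x /ind_degP xb ->];
  apply/ind_degP => D Db.
rewrite ccoef_hpi // ind_piE // !xb ?stay0 ?jump0 ?addr0 //.
case/andP: iP => i0 iN; rewrite parity_toggle2 //.
by rewrite gtn_eqF // addbF.
Qed.

Lemma ind_hc_deg i b : (0 < i <= n)%N ->
  (ind_hc i @: ind_deg b <= ind_deg (~~ b))%VS.
Proof.
move=> iP; apply/subvP => _ /memv_imgP[x /ind_degP xb ->];
  apply/ind_degP => D Db.
rewrite ccoef_hc /ind_c xb ?scaler0 // parity_full_toggle //.
by move: Db; case: b {xb}; case: (parity n D).
Qed.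

Definition ind : HClmod K n :=
  @HClMod K n ind_Hmod ind_hc ind_deg ind_hc_sq ind_hc_anti ind_hpi_hc
    ind_hpi_hc0 ind_hpi_hc1 ind_deg_sum ind_deg_dir ind_hpi_deg ind_hc_deg.

End InducedModule.

(** * Clifford products acting on an arbitrary supermodule *)

Section CliffordProducts.
Variables (K : fieldType) (n : nat) (P : HClmod K n).
Implicit Types (D : {set 'I_n}) (s t : seq nat) (x : P).

(** The product runs along any list [s], so that [c_D] can be cut around the positions where a
    generator acts. *)
Definition cliff_seq s D : 'End(P) :=
  foldr (fun k f => if bit k D then (hc k \o f)%VF else f) \1%VF s.
Definition cliff_prod D : 'End(P) := cliff_seq (iota 1 n) D.

Lemma cliff_seq_nil D x : cliff_seq [::] D x = x.
Proof. exact: id_lfunE. Qed.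

Lemma cliff_seq_cons k s D x :
  cliff_seq (k :: s) D x = if bit k D then hc k (cliff_seq s D x) else
    cliff_seq s D x.
Proof. by rewrite /=; case: ifP => // _; rewrite comp_lfunE. Qed.

Lemma cliff_seq_cat s t D x : cliff_seq (s ++ t) D x = cliff_seq s D
  (cliff_seq t D x).
Proof. by elim: s => [|k s IH]; rewrite ?cliff_seq_nil // !cliff_seq_cons IH.
  Qed.

Lemma eq_cliff_seq s D D' x : {in s, forall k, bit k D = bit k D'} ->
  cliff_seq s D x = cliff_seq s D' x.
Proof.
elim: s => [|k s IH] DD' //.
by rewrite !cliff_seq_cons DD' ?mem_head ?IH // => j js;
  rewrite DD' // inE js orbT.
Qed.

Lemma cliff_prod0 x : cliff_prod finset.set0 x = x.
Proof.
rewrite /cliff_prod; elim: (iota 1 n) => [|k s IH]; first exact: cliff_seq_nil.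
by rewrite cliff_seq_cons bit_set0.
Qed.

Lemma hc_cliff_seq j s D x : (0 < j <= n)%N ->
  {in s, forall k, (0 < k <= n)%N && (k != j)} ->
  hc j (cliff_seq s D x) = (-1) ^+ odd (count (fun k => bit k D) s) *:
    cliff_seq s D (hc j x).
Proof.
move=> jP; elim: s => [|k s IH] sP; first by rewrite !cliff_seq_nil scale1r.
have /andP[kP kj] := sP k (mem_head _ _).
have {}IH : hc j (cliff_seq s D x) = (-1) ^+ odd (count (fun k => bit k D) s)
  *: cliff_seq s D (hc j x).
  by apply: IH => i si; apply: sP; rewrite inE si orbT.
rewrite !cliff_seq_cons /=; case: (bit k D); rewrite /= ?add0n //.
by rewrite hc_anti // 1?eq_sym // IH linearZ /= -scaleNr signrN.
Qed.

Lemma hpi_cliff_seq i s D x : (0 < i < n)%N ->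
  {in s, forall k, [&& (0 < k <= n)%N, k != i & k != i.+1]} ->
  hpi i (cliff_seq s D x) = cliff_seq s D (hpi i x).
Proof.
move=> iP; elim: s => [|k s IH] sP; first by rewrite !cliff_seq_nil.
have /and3P[kP ki kSi] := sP k (mem_head _ _).
have {}IH : hpi i (cliff_seq s D x) = cliff_seq s D (hpi i x).
  by apply: IH => j js; apply: sP; rewrite inE js orbT.
by rewrite !cliff_seq_cons; case: (bit k D); rewrite ?hpi_hc // IH.
Qed.

Lemma cliff_prod_split j D x : (0 < j <= n)%N ->
  cliff_prod D x = cliff_seq (iota 1 j.-1) D
    (if bit j D then hc j (cliff_seq (iota j.+1 (n - j)) D x)
     else cliff_seq (iota j.+1 (n - j)) D x).
Proof.
move=> jP; rewrite -cliff_seq_cons -cliff_seq_cat /cliff_prod.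
have -> : j :: iota j.+1 (n - j) = iota (1 + j.-1) (n - j).+1 by rewrite add1n
  prednK //; lia.
by rewrite -iotaD; congr (cliff_seq (iota _ _) _ _); lia.
Qed.

(** [c_j] anticommutes with the factors below [j]; at position [j] it is inserted, or cancels
    against [c_j] with [c_j^2 = -1]. *)
Lemma hc_cliff_prod j D x : (0 < j <= n)%N ->
  hc j (cliff_prod D x) = (-1) ^+ parity j D *: cliff_prod (toggle j D) x.
Proof.
move=> jP; rewrite !(cliff_prod_split _ _ jP) bit_toggle // eqxx addbT.
have out k : (0 < k <= n)%N && (k != j) -> bit k (toggle j D) = bit k D.
  by case/andP => kP kj; rewrite bit_toggle // (negbTE kj) addbF.
have lo k : k \in iota 1 j.-1 -> (0 < k <= n)%N && (k != j).
  by rewrite mem_iota; lia.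
have hi k : k \in iota j.+1 (n - j) -> (0 < k <= n)%N && (k != j).
  by rewrite mem_iota; lia.
rewrite (@eq_cliff_seq (iota 1 _) (toggle j D) D); last by move=> k /lo/out.
rewrite (@eq_cliff_seq (iota j.+1 _) (toggle j D) D); last by move=> k /hi/out.
rewrite hc_cliff_seq //.
have -> : parity j D = odd (count (fun k => bit k D) (iota 1 j.-1)) (+) bit j D.
  by case: (j) jP => // j' _; rewrite parityS.
case: (bit j D) => /=; rewrite ?addbF // hc_sq // linearN scalerN -scaleNr.
by rewrite addbT signrN.
Qed.

Lemma cliff_prod_deg b D x : x \in hdeg P b ->
  cliff_prod D x \in hdeg P (b (+) parity n D).
Proof.
move=> xb; rewrite /cliff_prod /parity.
have: {in iota 1 n, forall k, (0 < k <= n)%N} by move=> k; rewrite mem_iota;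
  lia.
elim: (iota 1 n) => [|k s IH] sP; first by rewrite cliff_seq_nil addbF.
have {}IH : cliff_seq s D x \in hdeg P (b (+) odd (count (fun k => bit k D) s)).
  by apply: IH => j js; apply: sP; rewrite inE js orbT.
rewrite cliff_seq_cons /= oddD; case: (bit k D) => //=.
have := @hc_deg _ _ P k (b (+) odd (count (fun k => bit k D) s)) (sP k
  (mem_head _ _)).
by rewrite addbN => /subvP; apply; apply: memv_img.
Qed.

End CliffordProducts.

(** * The generators on sums of Clifford products applied to the image of [f] *)

Section HpiClifford.
Variables (K : fieldType) (n : nat) (N : Hmod K n) (P : HClmod K n).
Variable f : 'Hom(N, P).
Hypothesis f_hom : Hhom f.

(** [pi_i] commutes with [c_k] for [k] other than [i] and [i+1], so only the two middle factors
    matter; what remains of [pi_i] reaches [f v] and passes through [f]. *)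
Lemma hpi_cliff_prod i (D : {set 'I_n}) (v : N) : (0 < i < n)%N ->
  hpi i (cliff_prod P D (f v)) =
    cliff_prod P D (f (stay (hpi i : 'End('rV[K]_(hdim N))) i D v)) +
    cliff_prod P (toggle2 i D) (f (jump (hpi i : 'End('rV[K]_(hdim N))) i D v)).
Proof.
move=> iP.
have split2 E x : cliff_prod P E x = cliff_seq P (iota 1 i.-1) E
    (cliff_seq P [:: i; i.+1] E (cliff_seq P (iota i.+2 (n - i.+1)) E x)).
  rewrite -!cliff_seq_cat -?catA /cliff_prod.
  have -> : [:: i; i.+1] ++ iota i.+2 (n - i.+1) = iota (1 + i.-1) (n -
    i.+1).+2.
    by rewrite add1n prednK //; lia.
  by rewrite -iotaD; congr (cliff_seq P (iota _ _) _ _); lia.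
have out k : [&& (0 < k <= n)%N, k != i & k != i.+1] ->
  bit k (toggle2 i D) = bit k D.
  case/and3P => kP ki kSi; rewrite bit_toggle2 //.
  by rewrite (negbTE ki) (negbTE kSi) addbF.
have lo k : k \in iota 1 i.-1 -> [&& (0 < k <= n)%N, k != i & k != i.+1].
  by rewrite mem_iota; lia.
have hi k : k \in iota i.+2 (n - i.+1) ->
  [&& (0 < k <= n)%N, k != i & k != i.+1].
  by rewrite mem_iota; lia.
rewrite !split2.
rewrite (@eq_cliff_seq _ _ P (iota 1 _) (toggle2 i D) D);
  last by move=> k /lo/out.
rewrite (@eq_cliff_seq _ _ P (iota i.+2 _) (toggle2 i D) D);
  last by move=> k /hi/out.
rewrite hpi_cliff_seq // -homD; congr (cliff_seq _ _ _ _).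
set R := cliff_seq P (iota i.+2 _) D.
have RP y : R (hpi i y) = hpi i (R y) by rewrite /R hpi_cliff_seq.
have fP w : f (hpi i w) = hpi i (f w) by exact: f_hom.
have c1 (y : P) : hpi i (hc i.+1 y) = hc i (hpi i y + y) - hc i.+1 y.
  by rewrite -hpi_hc1 // addrK.
rewrite !cliff_seq_cons !cliff_seq_nil !bit_toggle2; try lia.
rewrite !eqxx orbT !addbT /stay /jump.
have [iP1 iP2] : (0 < i <= n)%N /\ (0 < i.+1 <= n)%N by lia.
case: (bit i D); case: (bit i.+1 D) => /=;
  rewrite ?(homD, homN, hom0, fP, RP, hpi_hc0) // ?(c1, homD, homN, hc_sq) //.
(* Both factors are present: the summand from [c_(i+1)^2 = -1] loses both of them, and [c_(i+1) c_i]
   is put back in order with a sign. *)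
- by rewrite opprK (hc_anti (i := i)) // ?ltn_eqF // (hc_anti (i :=
  i)) ?ltn_eqF // opprD !opprK.
- by rewrite add0r.
- by rewrite addrC.
- by rewrite addr0.
Qed.

(** [ind_c] is written by target index and [hc_cliff_prod] by source index; reindexing by the
    involution [toggle j] matches them. *)
Lemma hc_toggle_sum (j : nat) (F : {set 'I_n} -> N) : (0 < j <= n)%N ->
  \sum_D cliff_prod P D (f (ind_c j F D)) = hc j (\sum_D cliff_prod P D (f (F
    D))).
Proof.
move=> jP; have /andP[j0 jn] := jP; rewrite linear_sum (reindex_inj (can_inj
  (toggleK j))) /=.
apply: eq_bigr => D _; rewrite hc_cliff_prod // /ind_c toggleK parity_toggle //.
by rewrite leqnn addbT negbK !homZ.
Qed.

Lemma hpi_toggle_sum i (F : {set 'I_n} -> N) : (0 < i < n)%N ->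
  \sum_D cliff_prod P D (f (ind_pi (hpi i : 'End('rV[K]_(hdim N))) i F D)) =
  hpi i (\sum_D cliff_prod P D (f (F D))).
Proof.
move=> iP; rewrite linear_sum /=.
under eq_bigr => D _ do rewrite ind_piE // !homD.
under [RHS]eq_bigr => D _ do rewrite hpi_cliff_prod //.
rewrite !big_split; congr (_ + _) => /=.
(* Only the [jump] terms change their index set. *)
rewrite (reindex_inj (can_inj (toggle2K i))) /=.
by apply: eq_bigr => D _; rewrite toggle2K.
Qed.

End HpiClifford.

(** * Universal property of the induced supermodule *)

Section Universal.
Variables (K : fieldType) (n : nat) (N : Hmod K n).

Lemma mono_linear (D : {set 'I_n}) : linear (mono D : 'rV[K]_(hdim N) -> _).
Proof.
move=> a u v; apply: ccoef_inj; rewrite ccoefD ccoefZ !ccoefK;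
  apply/funext => E.
by rewrite ?ccoefK; case: ifP => // _; rewrite scaler0 addr0.
Qed.

Definition ind_iota : 'Hom(N, ind N) := lfun_of (mono_linear finset.set0).

Lemma ind_iotaE v : ind_iota v = mono finset.set0 v.
Proof. exact: lfun_ofE. Qed.

(** On the empty product there is nothing to move past: [stay] is the action of [pi_i] and [jump] is
    0. *)
Lemma ind_iota_hom : Hhom ind_iota.
Proof.
move=> i v iP; rewrite !ind_iotaE; apply: ccoef_inj.
rewrite [RHS]ccoef_hpi // !ccoefK; apply/funext => D.
rewrite ind_piE //; case: (eqVneq D finset.set0) => [->|D0].
  rewrite ifN ?jump0 ?addr0 /stay ?bit_set0 //.
  apply/eqP => /(congr1 (bit i)); rewrite bit_set0 bit_toggle2; last by lia.
  by rewrite bit_set0 eqxx.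
rewrite stay0 add0r; case: eqP => [->|_]; last by rewrite jump0.
by rewrite /jump !bit_set0.
Qed.

Lemma ind_iota_deg : (limg ind_iota <= hdeg (ind N) false)%VS.
Proof.
apply/subvP => _ /memv_imgP[v _ ->]; rewrite ind_iotaE; apply/ind_degP => D Dn.
rewrite ccoefK ifN //; apply: contraNneq Dn => ->.
rewrite /parity; elim: (iota 1 n) => //= k s; by rewrite bit_set0.
Qed.

Lemma hc_mono j (D : {set 'I_n}) (v : 'rV[K]_(hdim N)) : (0 < j <= n)%N ->
  ind_hc N j (mono D v) = (-1) ^+ parity j D *: mono (toggle j D) v.
Proof.
move=> /andP[j0 jn]; apply: ccoef_inj; rewrite ccoef_hc ccoefZ !ccoefK.
apply/funext => E; rewrite /ind_c (canF_eq (toggleK j)).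
case: eqP => [->|]; last by rewrite !scaler0.
by rewrite parity_toggle // leqnn addbT negbK.
Qed.

(** The image of [ind_iota] generates under the [c_j]: if [r] is in [D], then [c_D (x) v] is, up to
    sign, [c_(r+1)] applied to the product with that factor removed. Hence an induction on the size
    of [D]. *)
Lemma HClhom_ind_eq (P : HClmod K n) (g h : 'Hom(ind N, P)) :
  HClhom g -> HClhom h ->
  (forall v, g (ind_iota v) = h (ind_iota v)) -> g = h.
Proof.
move=> [_ gc _] [_ hcc _] gh.
suff eq_mono D (v : 'rV[K]_(hdim N)) : g (mono D v) = h (mono D v).
  apply/lfunP => x; rewrite (sum_mono x) !linear_sum; apply: eq_bigr => D _.
  exact: eq_mono.
have [m] := ubnP #|D|; elim: m D => // m IH D Dm.
case: (set_0Vmem D) => [->|[r rD]]; first by have := gh v; rewrite !ind_iotaE.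
have rP : (0 < r.+1 <= n)%N by exact: ltn_ord.
have : mono D v = (-1) ^+ parity r.+1 (toggle r.+1 D) *: ind_hc N r.+1 (mono
  (toggle r.+1 D) v).
  by rewrite hc_mono // toggleK scalerA -signr_addb addbb scale1r.
have mono_r : (#|toggle r.+1 D| < m)%N.
  apply: leq_trans (_ : #|D| <= m)%N => //; apply: proper_card;
    apply/properP; split.
    apply/fintype.subsetP => s; rewrite inE eqSS;
      case: eqP => [/val_inj ->|_]; rewrite ?addbF //.
  by exists r; rewrite // inE rD eqxx.
move=> ->; rewrite !homZ; congr (_ *: _).
have := gc r.+1 (mono (toggle r.+1 D) v : ind N) rP; rewrite /hc /= => ->.
have := hcc r.+1 (mono (toggle r.+1 D) v : ind N) rP; rewrite /hc /= => ->.
by rewrite IH.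
Qed.

Section Lift.
Variables (P : HClmod K n) (f : 'Hom(N, P)).
Hypotheses (f_hom : Hhom f) (f_deg : (limg f <= hdeg P false)%VS).

(** Commutation with the [c_j] forces [c_D (x) v] to be sent to [c_D f(v)]. *)
Definition ind_lift_fun (x : ind N) : P :=
  \sum_D cliff_prod P D (f (ccoef x D)).

Lemma ind_lift_linear : linear ind_lift_fun.
Proof.
move=> a x y; rewrite /ind_lift_fun scaler_sumr -big_split /=.
by apply: eq_bigr => D _; rewrite ccoefD ccoefZ !(homD, homZ).
Qed.

Definition ind_lift : 'Hom(ind N, P) := lfun_of ind_lift_linear.

Lemma ind_liftE x : ind_lift x = \sum_D cliff_prod P D (f (ccoef x D)).
Proof. exact: lfun_ofE. Qed.

Lemma ind_lift_hom : HClhom ind_lift.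
Proof.
split=> [i x iP|j x jP|b].
- rewrite !ind_liftE [ccoef _]ccoef_hpi //.
  exact: hpi_toggle_sum.
- rewrite !ind_liftE [ccoef _]ccoef_hc.
  exact: hc_toggle_sum.
apply/subvP => _ /memv_imgP[x /ind_degP xb ->]; rewrite ind_liftE.
apply: memv_suml => D _; case: (eqVneq (parity n D) b) => [<-|/xb ->];
  last first.
  by rewrite !hom0 mem0v.
(* The image of [f] is even, so [c_D f(v)] has degree [parity n D]. *)
apply: (@cliff_prod_deg _ _ P false); apply: (subvP f_deg);
  exact: memv_img (memvf _).
Qed.

Lemma ind_lift_iota v : ind_lift (ind_iota v) = f v.
Proof.
rewrite ind_liftE ind_iotaE ccoefK (bigD1 finset.set0) //= eqxx cliff_prod0.
rewrite big1 ?addr0 // => D /negbTE ->; by rewrite !hom0.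
Qed.

End Lift.

Lemma ind_induced : is_induced ind_iota.
Proof.
split; [exact: ind_iota_hom|exact: ind_iota_deg|].
move=> P f f_hom f_deg; exists (ind_lift f); split.
- exact: ind_lift_hom.
- exact: ind_lift_iota.
move=> h h_hom hf; apply: HClhom_ind_eq => //; first exact: ind_lift_hom.
by move=> v; rewrite hf ind_lift_iota.
Qed.

End Universal.

(** * Functoriality and exactness of induction *)

Section InducedMaps.
Variables (K : fieldType) (n : nat).

Definition ind_map_fun (M N : Hmod K n) (f : 'Hom(M, N)) (x : ind M) : ind N :=
  of_ccoef (fun D => f (ccoef x D) : 'rV[K]_(hdim N)).

Lemma ind_map_linear (M N : Hmod K n) (f : 'Hom(M, N)) : linear (ind_map_fun f).
Proof.
move=> a x y; apply: ccoef_inj; rewrite ccoefD ccoefZ !ccoefK;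
  apply/funext => D.
by rewrite ?ccoefK ccoefD ccoefZ homD homZ.
Qed.

Definition ind_map (M N : Hmod K n) (f : 'Hom(M, N)) : 'Hom(ind M, ind N) :=
  lfun_of (ind_map_linear f).

Lemma ccoef_map (M N : Hmod K n) (f : 'Hom(M, N)) x :
  ccoef (ind_map f x) = fun D => f (ccoef x D).
Proof. by rewrite lfun_ofE ccoefK. Qed.

Lemma ind_map_hom (M N : Hmod K n) (f : 'Hom(M, N)) :
  Hhom f -> HClhom (ind_map f).
Proof.
move=> f_hom; split=> [i x iP|j x jP|b].
- apply: ccoef_inj; rewrite [RHS]ccoef_hpi // !ccoef_map.
  apply/funext => D; rewrite [ccoef _]ccoef_hpi // /ind_pi.
  by case: (bit i D); case: (bit i.+1 D); rewrite !(homD, homN, f_hom).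
- apply: ccoef_inj; rewrite [RHS]ccoef_hc !ccoef_map.
  by apply/funext => D; rewrite [ccoef _]ccoef_hc /ind_c homZ.
apply/subvP => _ /memv_imgP[x /ind_degP xb ->].
by apply/ind_degP => D /xb; rewrite ccoef_map => ->; rewrite hom0.
Qed.

(** The induced maps act on each coefficient separately, so exactness is tested at each [D];
    preimages are chosen by the linear pseudo-inverses. *)
Lemma ind_exact (M' M M'' : Hmod K n) (f : 'Hom(M', M)) (g : 'Hom(M, M'')) :
  short_exact f g -> short_exact (ind_map f) (ind_map g).
Proof.
move=> [f_inj fg g_surj]; split.
- apply/eqP; rewrite -subv0; apply/subvP => x; rewrite memv_ker memv0.
  move=> /eqP x0; apply/eqP/ccoef_inj; rewrite ccoef0; apply/funext => D.
  have := congr1 (@^~ D) (congr1 (@ccoef K n _) x0);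
    rewrite ccoef_map ccoef0 => /eqP.
  by rewrite -memv_ker f_inj memv0 => /eqP.
- apply/eqP; rewrite eqEsubv; apply/andP; split; apply/subvP => x.
    move=> /memv_imgP[y _ ->]; rewrite memv_ker; apply/eqP/ccoef_inj.
    rewrite ccoef0 !ccoef_map; apply/funext => D; apply/eqP.
    by rewrite -memv_ker -fg memv_img ?memvf.
  rewrite memv_ker => /eqP x0; apply/memv_imgP.
  have xf D : ccoef x D \in limg f.
    rewrite fg memv_ker.
    by have := congr1 (@^~ D) (congr1 (@ccoef K n _) x0);
      rewrite ccoef_map ccoef0 => ->.
  exists (of_ccoef (fun D => (f^-1)%VF (ccoef x D) : 'rV[K]_(hdim M')));
    first exact: memvf.
  apply: ccoef_inj; rewrite ccoef_map ccoefK; apply/funext => D.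
  by rewrite limg_lfunVK.
apply/eqP; rewrite eqEsubv subvf; apply/subvP => x _; apply/memv_imgP.
exists (of_ccoef (fun D => (g^-1)%VF (ccoef x D) : 'rV[K]_(hdim M)));
  first exact: memvf.
apply: ccoef_inj; rewrite ccoef_map ccoefK; apply/funext => D.
by rewrite limg_lfunVK // g_surj memvf.
Qed.

End InducedMaps.

(** * Classes in the Grothendieck groups *)

Section Classes.
Variables (K : fieldType) (n : nat).

Lemma lspan_mem (V : lmodType K) (S : set V) v : S v -> lspan S v.
Proof.
by move=> Sv; rewrite -[v]addr0 -[v in v + _]scale1r; apply: lspanDZ => //;
  apply: lspan0.
Qed.

Lemma Hclass_exact (M' M M'' : Hmod K n) (f : 'Hom(M', M)) (g : 'Hom(M, M'')) :
  Hhom f -> Hhom g -> short_exact f g -> Hclass M = Hclass M' + Hclass M''.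
Proof.
move=> f_hom g_hom fg; rewrite /Hclass -[RHS]qpiD; apply/qpi_eq/lspan_mem.
by exists M', M, M'', f, g; split=> //; rewrite opprD addrA.
Qed.

Lemma HClclass_exact (M' M M'' : HClmod K n) (f : 'Hom(M', M)) (g :
  'Hom(M, M'')) :
  HClhom f -> HClhom g -> short_exact f g ->
    HClclass M = HClclass M' + HClclass M''.
Proof.
move=> f_hom g_hom fg; rewrite /HClclass -[RHS]qpiD; apply/qpi_eq/lspan_mem.
by left; exists M', M, M'', f, g; split=> //; rewrite opprD addrA.
Qed.

Lemma Hhom_id (M : Hmod K n) : Hhom (\1%VF : 'Hom(M, M)).
Proof. by move=> i v _; rewrite id_lfunE; congr (hpi i _);
  rewrite id_lfunE. Qed.

Lemma HClhom_id (M : HClmod K n) : HClhom (\1%VF : 'Hom(M, M)).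
Proof.
split=> [|i v _|b]; [exact: Hhom_id|by rewrite !id_lfunE|].
by apply/subvP => _ /memv_imgP[v vb ->]; rewrite id_lfunE.
Qed.

Lemma HClhom_comp (L M N : HClmod K n) (f : 'Hom(L, M)) (g : 'Hom(M, N)) :
  HClhom f -> HClhom g -> HClhom (g \o f)%VF.
Proof.
move=> [fp fc fd] [gp gc gd]; split=> [i v iP|i v iP|b]; rewrite ?comp_lfunE.
- by rewrite fp // gp.
- by rewrite fc // gc.
by rewrite limg_comp; apply: subv_trans (limgS _ (fd b)) (gd b).
Qed.

Lemma HClhom0 (M N : HClmod K n) : HClhom (0 : 'Hom(M, N)).
Proof.
split=> [i v _|i v _|b]; rewrite ?zero_lfunE ?linear0 //.
by rewrite lim0g sub0v.
Qed.

Lemma short_exact_zero (U : vectType K) : (forall v : U, v = 0) ->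
  short_exact (\1%VF : 'Hom(U, U)) (\1%VF : 'Hom(U, U)).
Proof.
move=> U0; have vs0 (A B : {vspace U}) : A = B.
  by apply/vspaceP => v; rewrite (U0 v) !mem0v.
by split; apply: vs0.
Qed.

(** Provides the zero term that turns an isomorphism into a short exact sequence. It is transparent
    because its dimension 0 has to be computed. *)
Definition zero_module : Hmod K n.
Proof.
by apply: (@HMod K n 0 (fun=> 0)) => *; apply/rowP => -[].
Defined.

Lemma ind_zero_module (v : ind zero_module) : v = 0.
Proof.
by apply: ccoef_inj; apply/funext => D; apply/rowP => -[].
Qed.

(** The identities form an exact sequence on a zero space, whence [[M] = [M] + [M]]. *)
Lemma HClclass_zero (M : HClmod K n) : (forall v : M, v = 0) -> HClclass M = 0.
Proof.
move=> /short_exact_zero M0.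
have := HClclass_exact (HClhom_id M) (HClhom_id M) M0.
by rewrite -[X in X = _]addr0 => /addrI.
Qed.

Lemma HClclass_iso (M N : HClmod K n) (f : 'Hom(M, N)) (g : 'Hom(N, M)) :
  HClhom f -> cancel f g -> cancel g f -> HClclass M = HClclass N.
Proof.
move=> f_hom fK gK; have f0 := HClhom0 N (ind zero_module).
rewrite (HClclass_exact f_hom f0); first by rewrite (HClclass_zero
  ind_zero_module) addr0.
split.
- by apply/eqP/lker0P; exact: can_inj fK.
- by apply/vspaceP => v; rewrite memv_ker zero_lfunE eqxx -[v]gK memv_img
  ?memvf.
by apply/vspaceP => v; rewrite (ind_zero_module v) !mem0v.
Qed.

(** [M] and [ind N] have the same universal property; the comparison maps are mutually inverse by
    uniqueness on each side. Any induced supermodule can thus be replaced by the model. *)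
Lemma induced_class (N : Hmod K n) (M : HClmod K n) (iota : 'Hom(N, M)) :
  is_induced iota -> HClclass M = HClclass (ind N).
Proof.
move=> [iota_hom iota_deg iota_univ].
have [g [g_hom gi _]] := iota_univ _ _ (@ind_iota_hom K n N) (@ind_iota_deg K
  n N).
pose f := ind_lift iota; have f_hom : HClhom f :=
  ind_lift_hom iota_hom iota_deg.
have fg1 : (f \o g)%VF = \1%VF.
  have [h [_ _ h_uniq]] := iota_univ _ _ iota_hom iota_deg.
  have fgi v : (f \o g)%VF (iota v) = iota v by rewrite comp_lfunE gi
    ind_lift_iota.
  have idi v : \1%VF (iota v) = iota v by rewrite id_lfunE.
  rewrite (h_uniq _ (HClhom_comp g_hom f_hom) fgi).
  by rewrite (h_uniq _ (HClhom_id M) idi).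
have gf1 : (g \o f)%VF = \1%VF.
  apply: HClhom_ind_eq (HClhom_comp f_hom g_hom) (HClhom_id _) _ => v.
  by rewrite comp_lfunE id_lfunE ind_lift_iota gi.
apply: (@HClclass_iso M (ind N) g f g_hom) => x; rewrite -comp_lfunE.
  by rewrite fg1 id_lfunE.
by rewrite gf1 id_lfunE.
Qed.

End Classes.

(** * Filtration of diagram modules by weight *)

Section Filtration.
Variables (K : fieldType) (n : nat).
Implicit Types (A B TT : {set 'S_n}) (T : 'S_n).

(** The sum makes the coordinate meaningful for every [T], with value 0 outside [TT]. *)
Definition dg_coord TT T (v : 'rV[K]_#|TT|) : K :=
  \sum_j v 0 j * (enum_val j == T)%:R.

Lemma dg_coord_linear TT T a u v :
  dg_coord T (a *: u + v : 'rV[K]_#|TT|) = a * dg_coord T u + dg_coord T v.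
Proof.
rewrite /dg_coord mulr_sumr -big_split; apply: eq_bigr => j _.
by rewrite !mxE mulrDl mulrA.
Qed.

Lemma dg_coord_basis TT T U : T \in TT ->
  dg_coord U (dg_basis K TT T) = (T == U)%:R.
Proof.
move=> TTT; rewrite /dg_coord -[T](enum_rankK_in TTT TTT).
set k := enum_rank_in _ _; rewrite dg_basis_enum (bigD1 k) //= big1 => [|j jk].
  by rewrite !mxE !eqxx mul1r addr0.
by rewrite !mxE (negbTE jk) andbF mul0r.
Qed.

Lemma dg_basis_sum TT (v : 'rV[K]_#|TT|) :
  v = \sum_(T in TT) dg_coord T v *: dg_basis K TT T.
Proof.
have coordE j : dg_coord (enum_val j) v = v 0 j.
  rewrite /dg_coord (bigD1 j) //= eqxx mulr1 big1 ?addr0 // => k /negbTE kj.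
  by rewrite (inj_eq enum_val_inj) kj mulr0.
rewrite big_enum_val /= [LHS]row_sum_delta; apply: eq_bigr => j _.
by rewrite coordE dg_basis_enum.
Qed.

(** Keeps the fillings common to [A] and [B] and kills the rest of [A]: an inclusion or a
    projection, according to which set is the larger. *)
Definition dg_rebase_fun A B (v : 'rV[K]_#|A|) : 'rV[K]_#|B| :=
  \row_k dg_coord (enum_val k) v.

Lemma dg_rebase_linear A B : linear (@dg_rebase_fun A B).
Proof. by move=> a u v; apply/rowP => k; rewrite !mxE dg_coord_linear. Qed.

Definition dg_rebase A B : 'Hom('rV[K]_#|A|, 'rV[K]_#|B|) :=
  lfun_of (@dg_rebase_linear A B).

Lemma dg_rebase_basis A B T : T \in A ->
  dg_rebase A B (dg_basis K A T) = dg_basis K B T.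
Proof.
move=> TA; rewrite lfun_ofE; apply/rowP => k; rewrite !mxE dg_coord_basis //.
by rewrite eq_sym.
Qed.

Definition dg_last_fun TT T (v : 'rV[K]_#|TT|) : 'rV[K]_1 :=
  const_mx (dg_coord T v).

Lemma dg_last_linear TT T : linear (@dg_last_fun TT T).
Proof. by move=> a u v; apply/rowP => k; rewrite !mxE dg_coord_linear. Qed.

Definition dg_last TT T : 'Hom('rV[K]_#|TT|, 'rV[K]_1) :=
  lfun_of (@dg_last_linear TT T).

Lemma dg_last_basis TT T U : T \in TT ->
  dg_last TT U (dg_basis K TT T) = const_mx (T == U)%:R.
Proof. by move=> TTT; rewrite lfun_ofE /dg_last_fun dg_coord_basis. Qed.

Lemma dg_hom_ext TT (V : vectType K) (f g : 'Hom('rV[K]_#|TT|, V)) :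
  (forall T, T \in TT -> f (dg_basis K TT T) = g (dg_basis K TT T)) -> f =1 g.
Proof.
move=> fg v; rewrite [v]row_sum_delta !linear_sum; apply: eq_bigr => j _.
by rewrite !linearZ -dg_basis_enum /= fg ?enum_valP.
Qed.

Definition weight T : nat := \sum_(k < n) k * posT T k.+1.

(** If [i] and [i+1] are at positions [p < q], then [(i-1) p + i q] becomes [(i-1) q + i p]: the
    weight drops by [q - p]. *)
Lemma weight_swap T i : (0 < i < n)%N -> i \notin DesT T ->
  (weight (swap_entries i T) < weight T)%N.
Proof.
move=> iP; rewrite mem_DesT // -leqNgt => asc.
have lt : (posT T i < posT T i.+1)%N.
  rewrite ltn_neqAle asc andbT; apply/eqP => /posT_inj E.
  by have : i = i.+1 by [apply: E; lia]; lia.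
have i0 : (i.-1 < n)%N by lia.
have i1 : (i < n)%N by lia.
(* The summation indices of the entries [i] and [i+1]. *)
pose a := Ordinal i0; pose b := Ordinal i1.
have ab : a != b by rewrite -val_eqE /=; lia.
rewrite /weight [X in (X < _)%N](bigD1 b) // [X in (_ < X)%N](bigD1 b) //.
rewrite [X in (_ + X < _)%N](bigD1 a) // [X in (_ < _ + X)%N](bigD1 a) //=.
rewrite (eq_bigr (fun k : 'I_n => k * posT T k.+1)%N); last first.
  move=> k /andP[kb ka]; rewrite swap2 //=.
  by apply: contra ka => /eqP E; rewrite -val_eqE /=; lia.
rewrite prednK; last by lia.
rewrite swap0 // swap1 //.
move: (\sum_(_ < _ | _) _)%N => S.
case: i iP lt {asc i0 i1 a b ab} => // i _.
by move: (posT T i.+1) (posT T i.+2) => p q /= pq; nia.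
Qed.

Section RemoveHeaviest.
Variables (TT : {set 'S_n}) (compat : ascent_compatible TT) (T0 : 'S_n).
Hypotheses (T0_in : T0 \in TT) (T0_max :
  forall T, T \in TT -> (weight T <= weight T0)%N).
Let A := TT :\ T0.

Lemma swap_neq_heaviest T i : (0 < i < n)%N -> i \notin DesT T -> T \in TT ->
  swap_entries i T != T0.
Proof.
move=> iP iT TTT; apply: contraTneq (weight_swap iP iT) => ->.
by rewrite -leqNgt T0_max.
Qed.

(** No swap at an ascent reaches [T0], so the same ascents are attacking for [A] as for [TT]. *)
Lemma remove_compatible : ascent_compatible A.
Proof.
have ascDes (T : 'S_n) (r s : 'I_n) : ascent_in T r s ->
    (0 < (T r).+1 < n)%N /\ (T r).+1 \notin DesT T.
  case/andP=> rs /eqP Ts; have iP : (0 < (T r).+1 < n)%N by have :=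
    ltn_ord (T s); rewrite Ts.
  by split=> //; rewrite mem_DesT // -{1}Ts !posT_entry -leqNgt ltnW.
move=> T T' r s; rewrite !in_setD1 => /andP[_ TT1] /andP[_ TT2] a1 a2.
have [i1 d1] := ascDes _ _ _ a1; have [i2 d2] := ascDes _ _ _ a2.
by rewrite !swap_neq_heaviest //=; apply: compat a1 a2.
Qed.

Let a := comp_of_set n (DesT T0).
Hypothesis Des_a : Des a = DesT T0.

(** The span of [A] is stable as no swap leads to [T0]. Modulo this span, a descent acts on [T0] by
    -1 and an ascent by 0, since its swap lies in [A] or is attacking. *)
Lemma remove_exact :
  [/\ Hhom (dg_rebase A TT : 'Hom(diagram_module K remove_compatible,
    diagram_module K compat)),
      Hhom (dg_last TT T0 : 'Hom(diagram_module K compat, simple_module K n a))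
    & short_exact (dg_rebase A TT : 'Hom(diagram_module K remove_compatible,
      diagram_module K compat))
        (dg_last TT T0 : 'Hom(diagram_module K compat, simple_module K n a))].
Proof.
have sub T : T \in A -> T \in TT /\ T != T0 by rewrite in_setD1 => /andP[].
split.
- move=> i v iP; rewrite -[LHS]comp_lfunE -[RHS]comp_lfunE;
  apply: dg_hom_ext => T TA.
  have [TTT TT0] := sub T TA.
  rewrite !comp_lfunE dg_rebase_basis // /= !dg_piE // /dg_act.
  case: ifP => iT; first by rewrite homN dg_rebase_basis.
  rewrite in_setD1 swap_neq_heaviest ?iT //=.
  by case: ifP => sT; rewrite ?hom0 // dg_rebase_basis // in_setD1 sT
    swap_neq_heaviest ?iT.
- move=> i v iP; rewrite -[LHS]comp_lfunE -[RHS]comp_lfunE;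
  apply: dg_hom_ext => T TTT.
  rewrite !comp_lfunE dg_last_basis // /= dg_piE // simple_piE /simple_coef
    Des_a /dg_act.
  case: (boolP (i \in DesT T)) => iT.
    rewrite homN dg_last_basis //; case: eqP => [<-|_];
      first by rewrite iT scaleN1r.
    by rewrite -[const_mx _]/(0 : 'rV[K]_1) scaler0 oppr0.
  rewrite [RHS](_ : _ = 0); last first.
    by case: eqP => [<-|_]; rewrite ?(negbTE iT) ?scale0r // -[const_mx _]/(0
      : 'rV[K]_1) scaler0.
  case: ifP => sT; last by rewrite hom0.
  by rewrite dg_last_basis // (negbTE (swap_neq_heaviest iP iT TTT)).
(* The projection back to [A] inverts the inclusion, on one side always and on the other where the
   coordinate at [T0] vanishes; this gives injectivity and exactness in the middle. *)
have rebaseK v : dg_rebase TT A (dg_rebase A TT v) = v.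
  rewrite -comp_lfunE -[RHS]id_lfunE; apply: dg_hom_ext => T TA.
  have [TTT _] := sub T TA.
  by rewrite comp_lfunE id_lfunE !dg_rebase_basis.
have rebaseN v : dg_coord T0 v = 0 -> dg_rebase A TT (dg_rebase TT A v) = v.
  move=> v0; rewrite [in RHS](dg_basis_sum v) {1}(dg_basis_sum v).
  rewrite !linear_sum; apply: eq_bigr => T TTT /=; rewrite !homZ.
  case: (eqVneq T T0) => [->|TT0]; first by rewrite v0 !scale0r.
  by rewrite !dg_rebase_basis // in_setD1 TT0.
split.
- by apply/eqP/lker0P; exact: can_inj rebaseK.
- apply/eqP; rewrite eqEsubv; apply/andP; split; apply/subvP => v.
    move=> /memv_imgP[w _ ->]; rewrite memv_ker -comp_lfunE.
    rewrite (_ : (_ \o _)%VF = 0) ?zero_lfunE ?eqxx //; apply/lfunP;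
      apply: dg_hom_ext => T TA.
    have [TTT /negbTE TT0] := sub T TA.
    by rewrite comp_lfunE zero_lfunE dg_rebase_basis // dg_last_basis // TT0.
  rewrite memv_ker lfun_ofE => /eqP/rowP/(_ 0); rewrite !mxE => /rebaseN <-.
  by rewrite memv_img ?memvf.
apply/eqP; rewrite eqEsubv subvf; apply/subvP => x _; apply/memv_imgP.
exists (x 0 0 *: dg_basis K TT T0); first exact: memvf.
rewrite homZ dg_last_basis // eqxx; apply/rowP => k.
by rewrite !mxE (ord1 k) mulr1.
Qed.

End RemoveHeaviest.

(** Stated for all ascent-compatible sets because removing a filling leaves the family [SShT], and
    for any additive [cl] in order to serve both characteristics. The induction is on the size of
    [TT]. *)
Lemma diagram_module_class (W : zmodType) (cl : Hmod K n -> W) :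
  (forall (M' M M'' : Hmod K n) (f : 'Hom(M', M)) (g : 'Hom(M, M'')),
     Hhom f -> Hhom g -> short_exact f g -> cl M = cl M' + cl M'') ->
  (forall T, Des (comp_of_set n (DesT T)) = DesT T) ->
  forall TT (compat : ascent_compatible TT),
    cl (diagram_module K compat) =
    \sum_(T in TT) cl (simple_module K n (comp_of_set n (DesT T))).
Proof.
move=> cl_exact DesK TT; have [m] := ubnP #|TT|.
elim: m TT => // m IH TT TTm compat; case: (set_0Vmem TT) => [TT0|[T1 T1T]].
  have M0 (v : diagram_module K compat) : v = 0.
    by apply/rowP => j; have := enum_valP j; rewrite {2}TT0 inE.
  rewrite big1 => [|T]; last by rewrite TT0 inE.
  (* For empty [TT] the value is its own double, hence 0. *)
  have := cl_exact _ _ _ _ _ (@Hhom_id K n _) (@Hhom_id K n _)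
    (short_exact_zero M0).
  by rewrite -[X in X = _]addr0 => /addrI.
case: (arg_maxnP weight T1T) => T0 T0T T0_max.
have [f_hom g_hom fg] := remove_exact compat T0T T0_max (DesK T0).
rewrite (cl_exact _ _ _ _ _ f_hom g_hom fg) IH; last first.
  by have T0T' : T0 \in TT := T0T; move: TTm; rewrite (cardsD1 T0) T0T'.
by rewrite [RHS](big_setD1 T0) // addrC.
Qed.

End Filtration.

(** * Compositions and their descent sets *)

Section Compositions.
Variable n : nat.
Implicit Types (X : {fset nat}).

Definition cuts X : seq nat := rcons [seq i <- iota 1 n.-1 | i \in X] n.

(** The sum telescopes; sortedness keeps the truncated subtractions exact. *)
Lemma sumn_take_pairmap a s k : sorted leq (a :: s) -> (k <= size s)%N ->
  (a + sumn (take k (pairmap (fun a b => b - a) a s)) = nth 0 (a :: s) k)%N.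
Proof.
elim: s a k => [|b s IH] a [|k] //=; rewrite ?addn0 // => /andP[ab bs] ks.
by rewrite addnA subnKC // IH.
Qed.

Lemma cuts_sorted X : (0 < n)%N -> sorted ltn (0%N :: cuts X).
Proof.
move=> n0; rewrite /= /cuts rcons_path; apply/andP; split.
  have : sorted ltn (0%N :: [seq i <- iota 1 n.-1 | i \in X]).
    have -> : 0%N :: [seq i <- iota 1 n.-1 | i \in X] =
              [seq i <- iota 0 n | (i == 0%N) || (i \in X)].
      case: n n0 => // m _ /=; congr (_ :: _); apply: eq_in_filter => i.
      by rewrite mem_iota; case: eqP => // ->.
    by apply: sorted_filter (iota_ltn_sorted _ _); exact: ltn_trans.
  by [].
have: last 0%N [seq i <- iota 1 n.-1 | i \in X] \in 0%N :: [seq i <- iota 1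
  n.-1 | i \in X].
  exact: mem_last.
rewrite inE mem_filter mem_iota => /orP[/eqP ->//|/andP[_]]; lia.
Qed.

Lemma pairmap_gt0 a s : sorted ltn (a :: s) ->
  all (fun k => 0 < k)%N (pairmap (fun a b => b - a)%N a s).
Proof. by elim: s a => //= b s IH a /andP[ab bs]; rewrite subn_gt0 ab IH. Qed.

Lemma sorted_ltn_leq s : sorted ltn s -> sorted leq s.
Proof. by apply: sub_sorted => i j /ltnW. Qed.

Lemma comp_of_setE X : (0 < n)%N ->
  comp_of_set n X = pairmap (fun a b => b - a)%N 0%N (cuts X).
Proof. by rewrite /cuts; case: n. Qed.

Lemma size_cuts X : (0 < n)%N -> (size (cuts X) <= n)%N.
Proof.
move=> n0; rewrite size_rcons size_filter.
by apply: leq_ltn_trans (count_size _ _) _; rewrite size_iota prednK.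
Qed.

Lemma comp_of_set_composition X : is_composition n (comp_of_set n X).
Proof.
case: (posnP n) => [n0|n0]; first by move: (n) n0 => _ ->.
rewrite comp_of_setE // /is_composition pairmap_gt0 ?cuts_sorted //=.
have := sumn_take_pairmap (sorted_ltn_leq (cuts_sorted X n0)) (leqnn _).
rewrite add0n take_oversize ?size_pairmap // => ->.
by rewrite -last_nth last_rcons.
Qed.

Lemma size_comp_of_set X : (size (comp_of_set n X) <= n)%N.
Proof.
case: (posnP n) => [n0|n0]; first by move: (n) n0 => _ ->.
by rewrite comp_of_setE // size_pairmap size_cuts.
Qed.

(** The partial sums of the parts are the [cuts], and [Des] leaves out the full sum, which is the
    final cut [n]. *)
Lemma Des_comp_of_set X : (forall i, i \in X -> (0 < i < n)%N) ->
  Des (comp_of_set n X) = X.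
Proof.
move=> XP; case: (posnP n) => [n0|n0].
  apply/fsetP => i; rewrite [in comp_of_set _ _]n0 /Des /=; apply/imfsetP/idP.
    by case=> k /=.
  by move=> /XP; rewrite n0 ltn0 andbF.
have srt := sorted_ltn_leq (cuts_sorted X n0).
rewrite comp_of_setE // /Des size_pairmap.
have takeE k : (k <= size (cuts X))%N ->
    sumn (take k (pairmap (fun a b => b - a)%N 0%N (cuts X))) = nth 0%N (0%N
      :: cuts X) k.
  by move=> kP; rewrite -(sumn_take_pairmap srt kP).
have cutsE k : (k < (size (cuts X)).-1)%N ->
  nth 0%N (cuts X) k = nth 0%N [seq i <- iota 1 n.-1 | i \in X] k.
  by rewrite /cuts size_rcons nth_rcons /= => ->.
apply/fsetP => i; apply/imfsetP/idP => [[k /= kP ->]|iX].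
  move: kP; rewrite mem_iota => kP; rewrite takeE; last by lia.
  case: k kP => // k kP; rewrite /= cutsE; last by lia.
  have: nth 0%N [seq i <- iota 1 n.-1 | i \in X] k \in [seq i <- iota 1 n.-1 |
    i \in X].
    by apply: mem_nth; move: kP; rewrite /cuts size_rcons /= add1n !ltnS.
  by rewrite mem_filter => /andP[].
have iF : i \in [seq i <- iota 1 n.-1 | i \in X].
  by rewrite mem_filter iX mem_iota; have := XP i iX; lia.
have lt : (index i [seq i <- iota 1 n.-1 | i \in X] < (size (cuts X)).-1)%N.
  by rewrite /cuts size_rcons /= index_mem.
exists (index i [seq i <- iota 1 n.-1 | i \in X]).+1.
  by rewrite /= mem_iota add1n !ltnS; exact: lt.
rewrite takeE; last exact: leq_trans lt (leq_pred _).
by rewrite [RHS]cutsE ?nth_index.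
Qed.

Lemma DesT_bounds (T : 'S_n) i : i \in DesT T -> (0 < i < n)%N.
Proof. by rewrite !inE /= mem_iota; case/andP; lia. Qed.

(** The characteristics are specified on the type [composition n] only, so the sequence has to be
    packed into it. *)
Lemma composition_of_set X :
  exists a : composition n, a = comp_of_set n X :> seq nat.
Proof.
set s := comp_of_set n X; have /andP[s0 /eqP sn] := comp_of_set_composition X.
have sz : (size (map inord s : seq 'I_n.+1) <= n)%N.
  by rewrite size_map size_comp_of_set.
have sE : map val (map inord s : seq 'I_n.+1) = s.
  rewrite -map_comp -[RHS]map_id; apply/eq_in_map => k ks /=.
  (* A part is at most the total [n], so [inord] does not alter it. *)
  rewrite inordK // ltnS -[leqRHS]sn (perm_sumn (perm_to_rem ks)) /=.
  exact: leq_addr.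
have P : is_composition n (map val (Bseq sz)).
  by rewrite /= sE; exact: comp_of_set_composition.
by exists (exist _ (Bseq sz) P).
Qed.

End Compositions.

Theorem theorem6p5 (R : realType)
    (ch : forall n : nat, {linear G0H R[i] n -> series R[i]})
    (cht : forall n : nat, {linear G0HCl R[i] n -> series R[i]})
    (ch_char : is_quasisymmetric_characteristic ch)
    (cht_char : is_peak_characteristic cht)
    (n : nat) (lambda : seq nat)
    (lambda_strict : is_strict_partition n lambda) :
  ch n (Hclass (SShT_module R[i] n lambda)) =
    \sum_(S in SShT n lambda) Ffun R[i] (comp_of_set n (DesT S))
  /\
  forall (M : HClmod R[i] n) (iota : 'Hom(SShT_module R[i] n lambda, M)),
    is_induced iota -> cht n (HClclass M) = schurQ R[i] n lambda.
Proof.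
have DesK (T : 'S_n) : Des (comp_of_set n (DesT T)) = DesT T.
  exact: Des_comp_of_set (@DesT_bounds n T).
case: ch_char cht_char => [_ _ ch_simple] [_ _ cht_simple];
  split=> [|M iota M_ind].
  rewrite (diagram_module_class (@Hclass_exact _ n) DesK) linear_sum.
  apply: eq_bigr => T _; have [a <-] := composition_of_set n (DesT T).
  exact: ch_simple.
rewrite (induced_class M_ind).
(* Additivity of this function is the exactness of induction. *)
rewrite (diagram_module_class (cl := fun N => HClclass (ind N)) _ DesK);
  last first.
  move=> M1 M2 M3 f g f_hom g_hom fg.
  exact: HClclass_exact (ind_map_hom f_hom) (ind_map_hom g_hom) (ind_exact fg).
rewrite linear_sum; apply: eq_bigr => T _.
have [a aE] := composition_of_set n (DesT T).
(* The model induced from a simple module is an instance of [M_a], where the peak characteristic is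
   prescribed. *)
rewrite -aE (cht_simple _ a _ _ (ind_induced _)) aE DesK.
by [].
Qed.
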